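(* If $P$ is a strongly planar poset, then there is a linear map from the order polytope $\mathcal{O}(P)$ to the flow polytope $\mathcal{F}_{G_P}$ which preserves relative volume.
   Context: For a finite poset $P$, the order polytope is $\mathcal{O}(P)=\{x\in[0,1]^P: x_s\le x_t \text{ whenever } s\le_P t\}$. $P$ is strongly planar if the Hasse diagram of $\widehat P=P\sqcup\{\hat0,\hat1\}$ has a planar embedding with all edges directed upward. Fix such an embedding and form $\widehat G$ by adding two edges from $\hat0$ to $\hat1$, one passing to the left of all poset elements and one to the right. $G_P$ is the truncated dual of $\widehat G$: vertices are the bounded faces of $\widehat G$ (the vertex of the infinite face and its incident edges are deleted), with one edge crossing each Hasse-diagram edge $x\to y$ ($x<y$ in $\widehat P$) that separates two bounded faces, oriented so that $y$ is on its left and $x$ on its right as one traverses it. For an acyclic directed graph with a unique source $s$ and sink $t$ (here the leftmost and rightmost bounded faces), the flow polytope $\mathcal{F}_G$ is the set of $fl:E(G)\to\mathbb{R}_{\ge0}$ with total outflow $1$ at $s$, total inflow $1$ at $t$, and inflow equal to outflow at every other vertex. Relative volume is volume measured with respect to the integer lattice in the affine span of the polytope. *)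

(* Defs.v *)
From HB Require Import structures.
From mathcomp Require Import all_boot all_order all_algebra.
From mathcomp Require Import all_classical all_reals all_analysis.
Set Implicit Arguments.
Unset Strict Implicit.
Unset Printing Implicit Defensive.
Import Order.TTheory GRing.Theory Num.Theory.
Import numFieldNormedType.Exports.
Local Open Scope classical_set_scope.
Local Open Scope ring_scope.

Section Hasse.
Variables (disp : Order.disp_t) (P : finPOrderType disp).

(* [inr false] is the added bottom element, [inr true] the added top. *)
Definition hat : finType := (P + bool)%type.
Definition hat0 : hat := inr false.
Definition hat1 : hat := inr true.

Definition hat_lt (x y : hat) : bool :=
  match x, y with
  | inl a, inl b => (a < b)%O
  | inl _, inr c => c
  | inr b, inl _ => ~~ b
  | inr b, inr c => ~~ b && c
  end.

Definition covers (x y : hat) : bool :=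
  hat_lt x y && [forall z, ~~ (hat_lt x z && hat_lt z y)].

Definition hasse_edge : finType := {e : hat * hat | covers e.1 e.2}.
Definition lower (e : hasse_edge) : hat := (val e).1.
Definition upper (e : hasse_edge) : hat := (val e).2.

End Hasse.

Section Arcs.
Variable R : realType.
Implicit Types (g : R -> R * R) (p q : R * R).

Definition upward_arc p q g : Prop :=
  [/\ {within `[0, 1], continuous g}, g 0 = p, g 1 = q
    & {in `[0, 1] &, {homo (fun t => (g t).2) : s t / s < t}}].

Definition trace g : set (R * R) := g @` `[0, 1].

Definition passes_left g q : Prop :=
  forall t, t \in `[0, 1] -> (g t).2 = q.2 -> (g t).1 < q.1.

Definition passes_right g q : Prop :=
  forall t, t \in `[0, 1] -> (g t).2 = q.2 -> q.1 < (g t).1.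

End Arcs.

Section Planarity.
Variables (R : realType) (disp : Order.disp_t) (P : finPOrderType disp).

Record upward_embedding := UpwardEmbedding {
  pos : hat P -> R * R;
  edge_arc : hasse_edge P -> R -> R * R;
  pos_inj : injective pos;
  arc_upward : forall e,
    upward_arc (pos (lower e)) (pos (upper e)) (edge_arc e);
  arc_avoids_vertices : forall e v t, t \in `]0, 1[ -> edge_arc e t <> pos v;
  arc_avoids_arcs : forall e f t,
    t \in `]0, 1[ -> e <> f -> ~ trace (edge_arc f) (edge_arc e t) }.

Definition strongly_planar : Prop := inhabited upward_embedding.

Definition hasse_drawing (D : upward_embedding) : set (R * R) :=
  range (pos D) `|` \bigcup_e trace (edge_arc D e).

(* The two extra edges must pass beside the whole diagram and not only beside
   the points of P; this matters only when P is empty, where the diagram is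
   the single edge from bottom to top. *)
Record side_edges (D : upward_embedding) := SideEdges {
  left_edge : R -> R * R;
  right_edge : R -> R * R;
  left_edge_upward : upward_arc (pos D (hat0 P)) (pos D (hat1 P)) left_edge;
  right_edge_upward : upward_arc (pos D (hat0 P)) (pos D (hat1 P)) right_edge;
  left_edge_passes : forall q, hasse_drawing D q ->
    q <> pos D (hat0 P) -> q <> pos D (hat1 P) -> passes_left left_edge q;
  right_edge_passes : forall q, hasse_drawing D q ->
    q <> pos D (hat0 P) -> q <> pos D (hat1 P) -> passes_right right_edge q }.

End Planarity.

Section Flows.

Record digraph (V : Type) := Digraph {
  vertices : set V;
  edge : finType;
  src : edge -> V;
  tgt : edge -> V;
  src_vertex : forall e, vertices (src e);
  tgt_vertex : forall e, vertices (tgt e) }.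

Variables (R : realType) (V : Type) (G : digraph V).

Definition outflow (fl : {ffun edge G -> R^o}) (v : V) : R :=
  \sum_(e | `[< src e = v >]) fl e.

Definition inflow (fl : {ffun edge G -> R^o}) (v : V) : R :=
  \sum_(e | `[< tgt e = v >]) fl e.

Definition flow_polytope (s t : V) : set {ffun edge G -> R^o} :=
  [set fl : {ffun edge G -> R^o} |
    [/\ forall e, 0 <= (fl e : R), outflow fl s = 1, inflow fl t = 1
      & forall v, vertices G v -> v <> s -> v <> t ->
          inflow fl v = outflow fl v]].

End Flows.

Section TruncatedDual.
Variables (R : realType) (disp : Order.disp_t) (P : finPOrderType disp).
Variables (D : upward_embedding R P) (S : side_edges D).

Definition drawing : set (R * R) :=
  hasse_drawing D `|` trace (left_edge S) `|` trace (right_edge S).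

Definition face_of (p : R * R) : set (R * R) :=
  connected_component (~` drawing) p.

Definition bounded_face (F : set (R * R)) : Prop :=
  (exists2 p, (~` drawing) p & F = face_of p) /\ bounded_set F.

(* The face containing the points immediately to the left (resp. right) of
   every interior point of the upward arc [g]. *)
Definition left_face (g : R -> R * R) : set (R * R) :=
  [set p | forall t, t \in `]0, 1[ ->
     \forall eps \near 0^'+, face_of ((g t).1 - eps, (g t).2) p].

Definition right_face (g : R -> R * R) : set (R * R) :=
  [set p | forall t, t \in `]0, 1[ ->
     \forall eps \near 0^'+, face_of ((g t).1 + eps, (g t).2) p].

Definition separates (e : hasse_edge P) : Prop :=
  [/\ bounded_face (left_face (edge_arc D e)),
      bounded_face (right_face (edge_arc D e))
    & left_face (edge_arc D e) <> right_face (edge_arc D e)].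

Definition dual_edge : finType := {e : hasse_edge P | `[< separates e >]}.

Lemma dual_src_bounded (e : dual_edge) :
  bounded_face (left_face (edge_arc D (val e))).
Proof. by case: e => e /= /asboolP[]. Qed.

Lemma dual_tgt_bounded (e : dual_edge) :
  bounded_face (right_face (edge_arc D (val e))).
Proof. by case: e => e /= /asboolP[]. Qed.

(* A dual edge crossing x -> y has y on its left exactly when it goes from the
   face on the left of the upward arc to the face on its right. *)
Definition truncated_dual : digraph (set (R * R)) :=
  @Digraph _ bounded_face dual_edge
    (fun e => left_face (edge_arc D (val e)))
    (fun e => right_face (edge_arc D (val e)))
    dual_src_bounded dual_tgt_bounded.

Definition leftmost_face : set (R * R) := right_face (left_edge S).
Definition rightmost_face : set (R * R) := left_face (right_edge S).

End TruncatedDual.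

Definition order_polytope (R : realType) (disp : Order.disp_t)
    (P : finPOrderType disp) : set {ffun P -> R^o} :=
  [set x | (forall s, 0 <= x s <= 1)
         /\ (forall s t, (s <= t)%O -> x s <= x t)].

Section Volume.
Variable R : realType.

Definition box (I : finType) (a b : {ffun I -> R^o}) : set {ffun I -> R^o} :=
  [set x | forall i, a i <= x i <= b i].

(* Lebesgue outer measure, i.e. Lebesgue measure on measurable sets. Covers are
   indexed by a set of naturals and not by a sequence, so that they may be
   finite: when I is empty the only box is a point, of volume 1. *)
Definition lebesgue_volume (I : finType) (A : set {ffun I -> R^o}) : \bar R :=
  ereal_inf [set v | exists (K : set nat) (a b : nat -> {ffun I -> R^o}),
    [/\ forall k i, a k i <= b k i,
        A `<=` \bigcup_(k in K) box (a k) (b k)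
      & v = \esum_(k in K) (\prod_i (b k i - a k i))%:E]].

Definition affine_span (I : finType) (S : set {ffun I -> R^o}) :
    set {ffun I -> R^o} :=
  [set x | exists (n : nat) (p : 'I_n -> {ffun I -> R^o}) (w : 'I_n -> R),
    [/\ forall j, S (p j), \sum_j w j = 1 & x = \sum_j w j *: p j]].

Definition integral_point (I : finType) (x : {ffun I -> R^o}) : Prop :=
  forall i, (x i : R) \is a Num.int.

Definition frame_point (I : finType) (d : nat) (o : {ffun I -> R^o})
    (b : 'I_d -> {ffun I -> R^o}) (c : {ffun 'I_d -> R^o}) : {ffun I -> R^o} :=
  o + \sum_j (c j : R) *: b j.

(* The vectors b form a basis of the lattice of integer points in the affine
   span of S, with origin o. *)
Definition lattice_frame (I : finType) (S : set {ffun I -> R^o}) (d : nat)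
    (o : {ffun I -> R^o}) (b : 'I_d -> {ffun I -> R^o}) : Prop :=
  [/\ range (frame_point o b) = affine_span S,
      injective (frame_point o b)
    & forall c, integral_point (frame_point o b c) <-> integral_point c].

(* The volume of A in lattice coordinates on the affine span of S. Two lattice
   frames differ by a unimodular affine map, so all of them give the same
   value; [xget] only selects it. *)
Definition relative_volume (I : finType) (S A : set {ffun I -> R^o}) : \bar R :=
  xget 0%E [set v | exists (d : nat) (o : {ffun I -> R^o})
      (b : 'I_d -> {ffun I -> R^o}),
    lattice_frame S o b /\ v = lebesgue_volume (frame_point o b @^-1` A)].

Definition affine_map (I J : finType)
    (phi : {ffun I -> R^o} -> {ffun J -> R^o}) : Prop :=
  exists (l : {linear {ffun I -> R^o} -> {ffun J -> R^o}})
         (c : {ffun J -> R^o}), forall x, phi x = l x + c.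

End Volume.

Arguments order_polytope R {disp} P.
Arguments strongly_planar R {disp} P.
Arguments upward_embedding R {disp} P.
Arguments flow_polytope R {V} G s t.

(* Main.v *)
Require Import Defs.
From HB Require Import structures.
From mathcomp Require Import all_boot all_order all_algebra.
From mathcomp Require Import all_classical all_reals all_analysis.
From mathcomp Require Import lra.
Import Order.TTheory GRing.Theory Num.Theory.
Import numFieldNormedType.Exports.
Set Implicit Arguments.
Unset Strict Implicit.
Unset Printing Implicit Defensive.
Local Open Scope classical_set_scope.
Local Open Scope ring_scope.

(** The map sends [x] to its differences [x_upper - x_lower] along the Hasse
    edges, with [x = 0] at the bottom and [x = 1] at the top.

    - It takes flow values: the net flow into a face [F] is linear in [x], and
      the coefficient of [x_v] is the difference of two telescoping sums along
      horizontal lines just below and just above [v], both of which only depend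
      on the faces beside [v].
    - It is onto: a maximal chain is the graph of a continuous function of the
      height, so every face lies on one side of it.  Adding up conservation over
      the faces on its left shows that a unit flow puts total weight 1 on every
      maximal chain; hence sums along chains from the bottom define a potential.
    - A point is integral iff its image is, so the lattice frames of the two
      polytopes correspond and give literally the same volumes. *)

(** * Topology of the plane *)

(** Faces are connected components of an open set, so the combinatorics of the dual graph has to be
    extracted from topology. Upwardness makes this affordable: every arc and every maximal chain is
    a graph over the height, so left and right are compared on one horizontal line, and a clopen
    argument takes the place of the Jordan curve theorem. A chain and a side edge share their end
    points, which closes off the region between them. The same separation, applied to a maximal
    chain through a given Hasse edge, shows that its two faces are bounded and distinct; hence every
    Hasse edge has a dual edge. Faces are never enumerated: only those beside some arc enter the
    sums. The side edges take part in the vertex balance as ordinary arcs; their outer faces are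
    unbounded, so for a bounded face they contribute only the indicators of the source and the
    sink. *)

Section PlaneTopology.
Variable R : realType.
Implicit Types (p q : R * R) (K : set (R * R)).

Lemma near_itvD (r y : R) : 0 < r -> \forall z \near y, y - r < z < y + r.
Proof.
move=> r0; apply/nbhs_ballP; exists r => //= z.
by rewrite -ball_normE /= distrC ltr_distl.
Qed.

Lemma nbhs_itvD (y : R) (Q : set R) : (\forall z \near y, Q z) ->
  exists2 r : R, 0 < r & forall z, y - r < z < y + r -> Q z.
Proof.
move=> /nbhs_ballP[r /= r0 rQ]; exists r => // z hz; apply: rQ.
by rewrite /= -ball_normE /= distrC ltr_distl.
Qed.

Lemma nbhs_plane p (Q : set (R * R)) : (\forall q \near p, Q q) ->
  exists2 r : R, 0 < r & forall x y,
    p.1 - r < x < p.1 + r -> p.2 - r < y < p.2 + r -> Q (x, y).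
Proof.
move=> /nbhs_ballP[r /= r0 rQ]; exists r => // x y hx hy; apply: rQ.
by split; rewrite /= -ball_normE /= distrC ltr_distl.
Qed.

(** [c] will be [1] or [-1], so that one statement serves heights just above and just below [y]. *)
Lemma near0_shift (c y : R) (Q : set R) : (\forall z \near y, Q z) ->
  \forall d \near 0^'+, Q (y + c * d).
Proof.
move=> Qy.
have h : (fun d : R => y + c * d) d @[d --> (0 : R)] --> y + c * 0.
  by apply: cvgD; [exact: cvg_cst | apply: cvgM; [exact: cvg_cst | exact: cvg_id]].
by move: h; rewrite mulr0 addr0 => /cvg_at_right_filter; apply.
Qed.

Lemma continuous_hline (y : R) : continuous (fun x : R => (x, y)).
Proof. by move=> x; exact: (cvg_pair cvg_id (cvg_cst y)). Qed.

Lemma continuous_vline (x : R) : continuous (fun y : R => (x, y)).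
Proof. by move=> y; exact: (cvg_pair (cvg_cst x) cvg_id). Qed.

Lemma component_eq K (L : set (R * R)) p q : connected L -> L `<=` K ->
  L p -> L q -> connected_component K p = connected_component K q.
Proof.
move=> cL LK Lp Lq; apply: same_connected_component.
exact: (connected_component_max Lp LK cL).
Qed.

Lemma component_hsegment K (y a b x1 x2 : R) :
  (forall x, a <= x <= b -> K (x, y)) -> a <= x1 <= b -> a <= x2 <= b ->
  connected_component K (x1, y) = connected_component K (x2, y).
Proof.
move=> hK h1 h2; apply: (@component_eq _ ((fun x => (x, y)) @` `[a, b])).
- apply: connected_continuous_connected; first exact: segment_connected.
  exact: continuous_subspaceT (@continuous_hline y).
- by move=> _ [x /= /[!in_itv]/= hx <-]; exact: hK.
- by exists x1; rewrite //= in_itv.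
- by exists x2; rewrite //= in_itv.
Qed.

Lemma component_vsegment K (x a b y1 y2 : R) :
  (forall y, a <= y <= b -> K (x, y)) -> a <= y1 <= b -> a <= y2 <= b ->
  connected_component K (x, y1) = connected_component K (x, y2).
Proof.
move=> hK h1 h2; apply: (@component_eq _ ((fun y => (x, y)) @` `[a, b])).
- apply: connected_continuous_connected; first exact: segment_connected.
  exact: continuous_subspaceT (@continuous_vline x).
- by move=> _ [y /= /[!in_itv]/= hy <-]; exact: hK.
- by exists y1; rewrite //= in_itv.
- by exists y2; rewrite //= in_itv.
Qed.

(** The points where [f] agrees with [f y] form a relatively clopen subset of a connected interval.
    [T] carries no topology, as [f] will take faces as values. *)
Lemma locally_constant_itv (T : Type) (f : R -> T) (a b : R) :
  (forall y, a < y < b -> \forall z \near y, f z = f y) ->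
  forall y z, a < y < b -> a < z < b -> f y = f z.
Proof.
move=> loc y z hy hz.
have cI : connected `]a, b[ by apply/connected_intervalP; exact: interval_is_interval.
pose B := [set t | a < t < b /\ f t = f y].
have BE : B = `]a, b[%classic.
  apply: cI; first by exists y.
  - exists (interior [set t | f t = f y]); first exact: open_interior.
    apply/seteqP; split=> t /=; rewrite in_itv /=.
      by move=> [ht ft]; split=> //; rewrite /interior/= -ft; exact: loc.
    by move=> [ht /interior_subset ft].
  - exists (~` interior [set t | f t <> f y]).
      by apply: open_closedC; exact: open_interior.
    apply/seteqP; split=> t /=; rewrite in_itv /=.
      by move=> [ht ft]; split=> //; move=> /interior_subset /=.
    move=> [ht nt]; split=> //; apply: contrapT => ne; apply: nt.
    by apply: filterS (loc t ht) => u /= ->.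
have : B z by rewrite BE /= in_itv.
by case.
Qed.

(* A region between two curves that meet at both ends and lie outside [K] is
   relatively clopen in [K]. *)
Lemma component_between_graphs K (f g : R -> R) (a b : R) p :
  continuous f -> continuous g -> f a = g a -> f b = g b -> a <= b ->
  (forall y, a <= y <= b -> ~ K (f y, y)) ->
  (forall y, a <= y <= b -> ~ K (g y, y)) ->
  a < p.2 < b -> f p.2 < p.1 < g p.2 -> K p ->
  connected_component K p `<=` [set q | a < q.2 < b /\ f q.2 < q.1 < g q.2].
Proof.
move=> cf cg fga fgb ab Kf Kg hp2 hp1 Kp.
set F := connected_component K p.
have FK : F `<=` K by exact: connected_component_sub.
have c2 : continuous (fun q : R * R => q.2) by move=> q; exact: cvg_snd.
have c1 : continuous (fun q : R * R => q.1) by move=> q; exact: cvg_fst.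
have cfs : continuous (fun q : R * R => q.1 - f q.2).
  move=> q; apply: cvgB; first exact: c1.
  by apply: (@continuous_comp _ _ _ snd f); [exact: c2 | exact: cf].
have cgs : continuous (fun q : R * R => g q.2 - q.1).
  move=> q; apply: cvgB; last exact: c1.
  by apply: (@continuous_comp _ _ _ snd g); [exact: c2 | exact: cg].
pose W := [set q : R * R | a < q.2 < b /\ f q.2 < q.1 < g q.2].
have -> : F = F `&` W; last by move=> q [].
symmetry; apply: (@component_connected _ K p).
- by exists p; split=> //; apply: connected_component_refl.
- exists W => //.
  rewrite (_ : W = ((fun q : R * R => q.2) @^-1` [set y | y > a]) `&`
    ((fun q : R * R => q.2) @^-1` [set y | y < b]) `&`
    ((fun q : R * R => q.1 - f q.2) @^-1` [set y | y > 0]) `&`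
    ((fun q : R * R => g q.2 - q.1) @^-1` [set y | y > 0])).
    do !apply: openI; apply: open_comp => //; try exact: open_gt; try exact: open_lt;
      by move=> q _; [exact: c2 || exact: cfs || exact: cgs].
  apply/seteqP; split=> q /=; rewrite !subr_gt0.
    by move=> [/andP[? ?] /andP[? ?]]; split.
  by move=> [[[? ?] ?] ?]; split; apply/andP.
- exists (((fun q : R * R => q.2) @^-1` [set y | y >= a]) `&`
    ((fun q : R * R => q.2) @^-1` [set y | y <= b]) `&`
    ((fun q : R * R => q.1 - f q.2) @^-1` [set y | y >= 0]) `&`
    ((fun q : R * R => g q.2 - q.1) @^-1` [set y | y >= 0])).
    do !apply: closedI; apply: closed_comp => //; try exact: closed_ge; try exact: closed_le;
      by move=> q _; [exact: c2 || exact: cfs || exact: cgs].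
  apply/seteqP; split=> q /= [Fq]; rewrite !subr_ge0.
    move=> [/andP[aq qb] /andP[fq qg]]; split=> //.
    by rewrite !ltW.
  move=> [[[aq qb] fq] qg]; split=> //.
  have Kq := FK q Fq.
  have nf : f q.2 != q.1.
    by apply/eqP => e; apply: (Kf q.2); [rewrite aq qb | rewrite e -surjective_pairing].
  have ng : g q.2 != q.1.
    by apply/eqP => e; apply: (Kg q.2); [rewrite aq qb | rewrite e -surjective_pairing].
  have lf : f q.2 < q.1 by rewrite lt_neqAle nf.
  have lg : q.1 < g q.2 by rewrite lt_neqAle eq_sym ng.
  split; last by rewrite lf.
  (* At heights [a] and [b] the two curves coincide, which leaves no room strictly between them. *)
  rewrite !lt_neqAle aq qb !andbT; apply/andP; split; apply/eqP => e.
    by have := lt_trans lf lg; rewrite -e fga ltxx.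
  by have := lt_trans lf lg; rewrite e fgb ltxx.
Qed.

End PlaneTopology.

(** * Drawings by graphs of functions *)

(* A planar drawing all of whose arcs are graphs [x = afun a y], extended by
   constants above and below the arc so as to be continuous on the line. *)
Record graph_drawing (R : realType) (V A : finType) := GraphDrawing {
  vpos : V -> R * R;
  alo : A -> V;
  aup : A -> V;
  afun : A -> R -> R;
  vpos_inj : injective vpos;
  alo_lt_aup : forall a, (vpos (alo a)).2 < (vpos (aup a)).2;
  afun_continuous : forall a, continuous (afun a);
  afun_lo : forall a y, y <= (vpos (alo a)).2 -> afun a y = (vpos (alo a)).1;
  afun_up : forall a y, (vpos (aup a)).2 <= y -> afun a y = (vpos (aup a)).1;
  afun_avoids_vpos : forall a v y,
    (vpos (alo a)).2 < y < (vpos (aup a)).2 -> (afun a y, y) <> vpos v;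
  afun_avoids_afun : forall a b y, a != b ->
    (vpos (alo a)).2 < y < (vpos (aup a)).2 ->
    (vpos (alo b)).2 <= y <= (vpos (aup b)).2 -> afun a y != afun b y }.

Section GraphDrawing.
Variables (R : realType) (V A : finType) (G : graph_drawing R V A).
Implicit Types (a b : A) (v : V) (x y : R) (p q : R * R) (F : set (R * R)).

Local Notation bot a := (vpos G (alo G a)).2.
Local Notation top a := (vpos G (aup G a)).2.

Definition crosses a y : bool := bot a < y < top a.
Definition spans a y : bool := bot a <= y <= top a.

Definition carrier : set (R * R) :=
  [set p | (exists v, p = vpos G v)
        \/ exists2 a, spans a p.2 & p.1 = afun G a p.2].

Definition face p : set (R * R) := connected_component (~` carrier) p.

Lemma crosses_spans a y : crosses a y -> spans a y.
Proof. by move=> /andP[h1 h2]; rewrite /spans !ltW. Qed.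

Lemma spans_vertex a y : spans a y -> ~~ crosses a y ->
  exists v, (afun G a y, y) = vpos G v.
Proof.
rewrite /spans /crosses !lt_neqAle => /andP[h1 h2]; rewrite h1 h2 !andbT.
rewrite negb_and !negbK => /orP[/eqP e|/eqP e].
  by exists (alo G a); rewrite afun_lo -e // -surjective_pairing.
by exists (aup G a); rewrite afun_up e // -surjective_pairing.
Qed.

Lemma near_not_vpos p v : p <> vpos G v -> \forall q \near p, q <> vpos G v.
Proof.
move=> ne; have h : open (~` [set vpos G v]).
  apply: closed_openC; apply: accessible_closed_set1.
  by apply: hausdorff_accessible; exact: norm_hausdorff.
by apply: (open_nbhs_nbhs (conj h _)).
Qed.

Lemma near_not_arc p a : ~ (spans a p.2 /\ p.1 = afun G a p.2) ->
  \forall q \near p, ~ (spans a q.2 /\ q.1 = afun G a q.2).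
Proof.
have c2 : continuous (fun q : R * R => q.2) by move=> q; exact: cvg_snd.
have c1 : continuous (fun q : R * R => q.1) by move=> q; exact: cvg_fst.
have cf : continuous (fun q : R * R => q.1 - afun G a q.2).
  move=> q; apply: cvgB; first exact: c1.
  by apply: (@continuous_comp _ _ _ snd); [exact: c2 | exact: afun_continuous].
move=> np; have h : closed [set q : R * R | spans a q.2 /\ q.1 = afun G a q.2].
  rewrite (_ : [set q | _] = ((fun q : R * R => q.2) @^-1` [set y | y >= bot a]) `&`
     ((fun q : R * R => q.2) @^-1` [set y | y <= top a]) `&`
     ((fun q : R * R => q.1 - afun G a q.2) @^-1` [set 0])).
    do !apply: closedI; apply: closed_comp => //;
      try exact: closed_ge; try exact: closed_le; try exact: closed_eq;
      by move=> q _; [exact: c2 || exact: cf].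
  apply/seteqP; split=> q /=.
    by move=> [/andP[h1 h2] ->]; split; [split|rewrite subrr].
  by move=> [[h1 h2] /eqP]; rewrite subr_eq0 => /eqP h3; split=> //; apply/andP.
exact: (open_nbhs_nbhs (conj (closed_openC h) _)).
Qed.

Lemma near_off_carrier p : ~ carrier p -> \forall q \near p, ~ carrier q.
Proof.
move=> np.
have /filter_forall hv v : \forall q \near p, q <> vpos G v.
  by apply: near_not_vpos => e; apply: np; left; exists v.
have /filter_forall ha a : \forall q \near p, ~ (spans a q.2 /\ q.1 = afun G a q.2).
  apply: near_not_arc => -[h1 h2].
  by apply: np; right; exists a.
by near=> q; case=> [[v]|[a h1 h2]]; [exact: (near hv q) | exact: (near ha q _ a)].
Unshelve. all: by end_near. Qed.

(** The vertices and the other arcs are finitely many closed sets that miss an interior point of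
    [a], so near that point [a] is the whole drawing. *)
Lemma near_arc a y : crosses a y ->
  \forall q \near (afun G a y, y), q.1 <> afun G a q.2 -> ~ carrier q.
Proof.
move=> cy.
have /filter_forall hv v : \forall q \near (afun G a y, y), q <> vpos G v.
  by apply: near_not_vpos; exact: afun_avoids_vpos.
have /filter_forall hb b : \forall q \near (afun G a y, y),
    b != a -> ~ (spans b q.2 /\ q.1 = afun G b q.2).
  case: (eqVneq b a) => [->|ba].
    by apply: filterE => q.
  apply: filterS (near_not_arc (p := (afun G a y, y)) (a := b) _) => [q h _ //|/= -[h1 /eqP]].
  by apply/negP; apply: (afun_avoids_afun _ cy h1); rewrite eq_sym.
near=> q => qa; case=> [[v]|[b h1 h2]]; first exact: (near hv q).
case: (eqVneq b a) => [e|ba]; first by apply: qa; rewrite -e.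
exact: (near hb q _ b).
Unshelve. all: by end_near. Qed.

Definition sgn (s : bool) : R := if s then 1 else -1.

(* The face met just beside [(afun a y, y)], on the right if [s], else on the left. *)
Definition side_at s a y : set (R * R) :=
  [set p | \forall eps \near 0^'+, face (afun G a y + sgn s * eps, y) p].

Lemma eventual_face (f : R -> R * R) F :
  (\forall eps \near 0^'+, face (f eps) = F) ->
  [set p | \forall eps \near 0^'+, face (f eps) p] = F.
Proof.
move=> h; apply/seteqP; split=> p /=.
  move=> hp; near (0 : R)^'+ => eps.
  by rewrite -(near h eps _) //; exact: (near hp eps).
by move=> Fp; apply: filterS h => e ->.
Unshelve. all: by end_near. Qed.

(** A rectangle of half-width [r] around the point meets the drawing only in [a], and near height
    [y] the arc stays within [r / 2] of [afun G a y]. From beside the arc at a nearby height one can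
    thus move horizontally to the abscissa [afun G a y + sgn s * (r / 2)] and then vertically to
    height [y] without meeting the drawing. *)
Lemma side_at_locally_constant s a y : crosses a y ->
  exists2 F, (\forall eps \near 0^'+, ~ carrier (afun G a y + sgn s * eps, y))
    & \forall z \near y, \forall eps \near 0^'+, face (afun G a z + sgn s * eps, z) = F.
Proof.
move=> cy; have [r r0 hr] := nbhs_plane (near_arc cy).
exists (face (afun G a y + sgn s * (r / 2), y)).
  near=> e; have e0 : 0 < e by near: e; exact: nbhs_right_gt.
  have er : e < r by near: e; exact: nbhs_right_lt.
  by apply: hr => /=; case: s => /=; lra.
have r2 : 0 < r / 2 by lra.
have hz : \forall z \near y, afun G a y - r / 2 < afun G a z < afun G a y + r / 2.
  exact: (@afun_continuous _ _ _ G a y _ (near_itvD _ r2)).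
have [d d0 hd] := nbhs_itvD (filterI hz (near_itvD y r0)).
near=> z; have zd : y - d < z < y + d by near: z; exact: near_itvD.
have [hz1 hz2] := hd z zd.
near=> e.
have e0 : 0 < e by near: e; exact: nbhs_right_gt.
have er : e < afun G a z - (afun G a y - r / 2).
  by near: e; apply: nbhs_right_lt; lra.
have er' : e < afun G a y + r / 2 - afun G a z.
  by near: e; apply: nbhs_right_lt; lra.
transitivity (face (afun G a y + sgn s * (r / 2), z)); last first.
  apply: (@component_vsegment _ _ _ (Num.min y z) (Num.max y z)).
  - move=> u hu; have ud : y - d < u < y + d.
      by move: hu; rewrite /Num.min /Num.max; case: (ltP y z) => ? ?; lra.
    by have [u1 u2] := hd u ud; apply: hr => //=; case: s => /=; lra.
  - by rewrite /Num.min /Num.max; case: (ltP y z) => ?; lra.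
  - by rewrite /Num.min /Num.max; case: (ltP y z) => ?; lra.
case: s => /=.
- apply: (@component_hsegment _ _ _ (afun G a z + 1 * e) (afun G a y + 1 * (r / 2))); try lra.
  by move=> x hx; apply: hr => //=; lra.
- apply: (@component_hsegment _ _ _ (afun G a y + -1 * (r / 2)) (afun G a z + -1 * e)); try lra.
  by move=> x hx; apply: hr => //=; lra.
Unshelve. all: by end_near. Qed.

(** The mid height is an arbitrary interior height; by [side_atE] any other one gives the same
    face. *)
Definition side s a : set (R * R) := side_at s a ((bot a + top a) / 2).

Lemma side_atE s a y : crosses a y -> side_at s a y = side s a.
Proof.
move=> cy; apply: (@locally_constant_itv _ _ _ (bot a) (top a)) => //; last first.
  by have := alo_lt_aup G a; lra.
move=> z cz; have [F _ hF] := side_at_locally_constant s cz.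
have hz : side_at s a z = F by apply: eventual_face; exact: (nbhs_singleton hF).
by rewrite hz; apply: filterS hF => u hu; exact: eventual_face.
Qed.

Lemma near_side s a y : crosses a y ->
  \forall eps \near 0^'+, ~ carrier (afun G a y + sgn s * eps, y)
    /\ side s a = face (afun G a y + sgn s * eps, y).
Proof.
move=> cy; have [F h1 hF] := side_at_locally_constant s cy.
have h2 := nbhs_singleton hF.
have e : side s a = F by rewrite -(side_atE s cy); exact: eventual_face.
by rewrite e; apply: filterS2 h1 h2 => eps ? ->.
Qed.

Lemma side_left a x y : crosses a y -> x < afun G a y ->
  (forall z, x <= z < afun G a y -> ~ carrier (z, y)) -> side false a = face (x, y).
Proof.
move=> cy xa h; near (0 : R)^'+ => e.
have e0 : 0 < e by near: e; exact: nbhs_right_gt.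
have ex : e < afun G a y - x by near: e; apply: nbhs_right_lt; rewrite subr_gt0.
have [_ ->] : ~ carrier (afun G a y + sgn false * e, y)
    /\ side false a = face (afun G a y + sgn false * e, y).
  by near: e; exact: near_side.
rewrite /=; apply: (@component_hsegment _ _ _ x (afun G a y + -1 * e)); try lra.
by move=> z hz; apply: h; lra.
Unshelve. all: by end_near. Qed.

End GraphDrawing.

(** * Counting faces along horizontal lines *)

Section FaceCounting.
Variables (R : realType) (V A : finType) (G : graph_drawing R V A).
Implicit Types (a b : A) (v : V) (x y : R) (F : set (R * R)).

Local Notation bot a := (vpos G (alo G a)).2.
Local Notation top a := (vpos G (aup G a)).2.
Local Notation is_face F p := (`[< face G p = F >]%:R : R).

(** The change of the indicator of [F] on crossing [a] from left to right. *)
Definition jump F a : R :=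
  `[< side G true a = F >]%:R - `[< side G false a = F >]%:R.

(** An arc that spans height [y] without crossing it has an end point there, so the condition on
    vertices already takes care of it. *)
Lemma face_clear_segment y x1 x2 : x1 <= x2 ->
  ~ carrier G (x1, y) -> ~ carrier G (x2, y) ->
  (forall v, (vpos G v).2 = y -> ~~ (x1 < (vpos G v).1 < x2)) ->
  (forall a, crosses G a y -> ~~ (x1 < afun G a y < x2)) ->
  forall z, x1 <= z <= x2 -> ~ carrier G (z, y).
Proof.
move=> x12 n1 n2 hv ha z hz cz.
have [e|z1] := eqVneq z x1; first by apply: n1; rewrite -e.
have [e|z2] := eqVneq z x2; first by apply: n2; rewrite -e.
have hz' : x1 < z < x2.
  by move: hz; rewrite !le_eqVlt eq_sym (negbTE z1) (negbTE z2).
have nv v : (z, y) <> vpos G v.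
  by move=> e; have := hv v; rewrite -e /= hz' => /(_ erefl).
case: cz => [[v]|[a /= sa za]]; first exact: nv.
have [ca|nca] := boolP (crosses G a y).
  by have := ha a ca; rewrite -za hz'.
by have [v] := spans_vertex sa nca; rewrite -za; exact: nv.
Qed.

(** The jumps telescope. The induction is on the number of arcs met: [x1] moves to a point just
    right of the leftmost of them, and the indicator of [F] changes by its jump. *)
Lemma sum_jump_between F y x1 x2 : x1 <= x2 ->
  ~ carrier G (x1, y) -> ~ carrier G (x2, y) ->
  (forall v, (vpos G v).2 = y -> ~~ (x1 < (vpos G v).1 < x2)) ->
  \sum_(a | crosses G a y && (x1 < afun G a y < x2)) jump F a
  = is_face F (x2, y) - is_face F (x1, y).
Proof.
have [n] := ubnP #|[pred a | crosses G a y && (x1 < afun G a y < x2)]|.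
elim: n x1 => // n IH x1 /ltnSE cn x12 n1 n2 hv.
pose between := [pred a | crosses G a y && (x1 < afun G a y < x2)].
have [a0 h0|no] := pickP between; last first.
  rewrite big_pred0 //.
  have -> : face G (x2, y) = face G (x1, y); last by rewrite subrr.
  apply: (@component_hsegment _ _ _ x1 x2); rewrite ?lexx ?x12 //.
  apply: face_clear_segment => // a ca.
  by have := no a; rewrite /= ca => /negbT.
case: (Order.TotalTheory.arg_minP (fun a => afun G a y) h0) => a /= /andP[ca ha] amin.
have left_clear z : x1 <= z < afun G a y -> ~ carrier G (z, y).
  move=> hz; have [->//|z1] := eqVneq z x1.
  have hz1 : x1 < z by move: hz; rewrite le_eqVlt eq_sym (negbTE z1) => /andP[].
  have nv v : (z, y) <> vpos G v.
    by move=> e; have := hv v; rewrite -e /= => /(_ erefl)/negP; apply; lra.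
  case=> [[v]|[b /= sb zb]]; first exact: nv.
  have [cb|ncb] := boolP (crosses G b y).
    have hb : crosses G b y && (x1 < afun G b y < x2) by rewrite cb /=; lra.
    by have := amin b hb; lra.
  by have [v] := spans_vertex sb ncb; rewrite -zb; exact: nv.
have lE : side G false a = face G (x1, y).
  by apply: side_left => //; lra.
near (0 : R)^'+ => e.
have e0 : 0 < e by near: e; exact: nbhs_right_gt.
have ex2 : e < x2 - afun G a y by near: e; apply: nbhs_right_lt; lra.
have [n1' rE] : ~ carrier G (afun G a y + sgn R true * e, y)
    /\ side G true a = face G (afun G a y + sgn R true * e, y).
  by near: e; exact: near_side.
(* The step past [a] is short enough to skip no other arc. *)
have eb b : afun G a y < afun G b y -> e < afun G b y - afun G a y.
  move: b; near: e; apply: filter_forall => b.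
  have [ab|ab] := ltP (afun G a y) (afun G b y); last by apply: filterE => e; lra.
  by apply: filterS (@nbhs_right_lt _ 0 (afun G b y - afun G a y) _) => [//|]; lra.
rewrite /= mul1r in n1' rE.
rewrite (bigD1 a) /=; last by rewrite ca.
have PE b : (crosses G b y && (x1 < afun G b y < x2)) && (b != a)
    = crosses G b y && (afun G a y + e < afun G b y < x2).
  have [cb/=|//] := boolP (crosses G b y).
  apply/idP/idP.
    move=> /andP[hb ba].
    have := afun_avoids_afun ba cb (crosses_spans ca); move/eqP => ne.
    have := amin b; rewrite cb hb => /(_ isT) ab.
    have ab' : afun G a y < afun G b y by lra.
    by have := eb b ab'; lra.
  move=> hb; apply/andP; split; first by lra.
  by apply/eqP => E; move: hb; rewrite E; lra.
rewrite (eq_bigl _ _ PE) IH //; last 2 first.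
- by lra.
- move=> v hy; apply/negP => hv'; have := hv v hy => /negP; apply; lra.
- by rewrite /jump lE rE; lra.
- apply: (leq_trans _ cn); apply: proper_card; apply/properP; split.
    apply/fintype.subsetP => b; rewrite !inE => hb.
    by have := PE b; rewrite hb => /andP[].
  by exists a; rewrite !inE ?ca ?ha //=; lra.
Unshelve. all: by end_near. Qed.

Definition endpoint (s : bool) a : V := if s then alo G a else aup G a.

(** Finitely many vertices and arcs give finitely many abscissas at this height; a small [e] keeps
    clear of all those that differ from the abscissa of [v]. *)
Lemma near_carrier_vertex v : \forall e \near 0^'+,
  [/\ ~ carrier G ((vpos G v).1 - e, (vpos G v).2),
      ~ carrier G ((vpos G v).1 + e, (vpos G v).2)
    & forall b, afun G b (vpos G v).2 != (vpos G v).1 ->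
       afun G b (vpos G v).2 < (vpos G v).1 - e
       \/ (vpos G v).1 + e < afun G b (vpos G v).2].
Proof.
set x0 := (vpos G v).1; set y0 := (vpos G v).2.
have far (z : R) : \forall e \near 0^'+, z != x0 -> z < x0 - e \/ x0 + e < z.
  have [zx|zx|->] := ltgtP z x0; last by apply: filterE.
    near=> e => _; left; suff : e < x0 - z by lra.
    by near: e; apply: nbhs_right_lt; lra.
  near=> e => _; right; suff : e < z - x0 by lra.
  by near: e; apply: nbhs_right_lt; lra.
have /filter_forall fa b := far (afun G b y0).
have /filter_forall fv w := far (vpos G w).1.
near=> e.
have e0 : 0 < e by near: e; exact: nbhs_right_gt.
have ha b : afun G b y0 != x0 -> afun G b y0 < x0 - e \/ x0 + e < afun G b y0.
  by move: b; near: e.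
have hw w : (vpos G w).1 != x0 -> (vpos G w).1 < x0 - e \/ x0 + e < (vpos G w).1.
  by move: w; near: e.
have off (z : R) : z = x0 - e \/ z = x0 + e -> ~ carrier G (z, y0).
  move=> hz [[w ew]|[b /= _ zb]].
    have := hw w; rewrite -ew /=; have [e1|_ /(_ isT)] := eqVneq z x0; lra.
  by have := ha b; rewrite -zb /=; have [e1|_ /(_ isT)] := eqVneq z x0; lra.
by split=> //; apply: off; [left|right].
Unshelve. all: by end_near. Qed.

(* Just above (resp. below) a vertex, the arcs met between its two sides are
   exactly those that start (resp. end) there. *)
Lemma sum_jump_vertex s F v : \forall e \near 0^'+,
  \sum_(a | endpoint s a == v) jump F a
  = is_face F ((vpos G v).1 + e, (vpos G v).2)
    - is_face F ((vpos G v).1 - e, (vpos G v).2).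
Proof.
set x0 := (vpos G v).1; set y0 := (vpos G v).2.
near=> e.
have e0 : 0 < e by near: e; exact: nbhs_right_gt.
have [offl offr far] : [/\ ~ carrier G (x0 - e, y0), ~ carrier G (x0 + e, y0)
    & forall b, afun G b y0 != x0 -> afun G b y0 < x0 - e \/ x0 + e < afun G b y0].
  by near: e; exact: near_carrier_vertex.
have [r1 r10 hr1] := nbhs_plane (near_off_carrier offl).
have [r2 r20 hr2] := nbhs_plane (near_off_carrier offr).
(* The shifted line must carry no vertex for [sum_jump_between] to apply to it. *)
have /filter_forall levels w : \forall d \near 0^'+, (vpos G w).2 != y0 + sgn R s * d.
  have [->|ne] := eqVneq (vpos G w).2 y0.
    near=> d; have d0 : 0 < d by near: d; exact: nbhs_right_gt.
    by case: (s) => /=; apply/eqP; lra.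
  have hn : \forall z \near y0, (vpos G w).2 != z.
    have [h|h|h] := ltgtP (vpos G w).2 y0; last by rewrite h eqxx in ne.
      have r0 : 0 < y0 - (vpos G w).2 by rewrite subr_gt0.
      by apply: filterS (near_itvD y0 r0) => z ?; apply/eqP; lra.
    have r0 : 0 < (vpos G w).2 - y0 by rewrite subr_gt0.
    by apply: filterS (near_itvD y0 r0) => z ?; apply/eqP; lra.
  exact: (@near0_shift R (sgn R s) y0 _ hn).
have /filter_forall arcs b : \forall d \near 0^'+,
    crosses G b (y0 + sgn R s * d)
      && (x0 - e < afun G b (y0 + sgn R s * d) < x0 + e) = (endpoint s b == v).
  have cvgb (Q : set R) : (\forall z \near afun G b y0, Q z) ->
      \forall d \near 0^'+, Q (afun G b (y0 + sgn R s * d)).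
    move=> hQ; apply: (@near0_shift R _ _ [set z | Q (afun G b z)]).
    exact: (@afun_continuous _ _ _ G b y0 _ hQ).
  have lt := alo_lt_aup G b.
  have [ev|nev] := eqVneq (endpoint s b) v.
    have bx : afun G b y0 = x0.
      by rewrite /x0 /y0 -ev /endpoint; case: (s); [apply: afun_lo | apply: afun_up].
    near=> d; have d0 : 0 < d by near: d; exact: nbhs_right_gt.
    have db : d < top b - bot b by near: d; apply: nbhs_right_lt; lra.
    have hx : x0 - e < afun G b (y0 + sgn R s * d) < x0 + e.
      by near: d; apply: (cvgb [set z | x0 - e < z < x0 + e]); rewrite bx; exact: near_itvD.
    rewrite hx andbT; move: ev; rewrite /crosses /y0 /endpoint.
    by case: (s) => /= <-; lra.
  (* The arc [b] is not incident to [v] on this side. If it reaches the heights just beyond [y0], it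
     misses [x0] at height [y0], hence lies outside the window of half-width [e] and stays outside
     by continuity; otherwise it does not cross those heights at all. *)
  case: (boolP (if s then bot b <= y0 < top b else bot b < y0 <= top b)) => hy.
    have bx : afun G b y0 != x0.
      apply/eqP => bx.
      have ep : (afun G b y0, y0) = vpos G v by rewrite bx [RHS]surjective_pairing.
      have [cb|ncb] := boolP (crosses G b y0); first exact: (afun_avoids_vpos cb ep).
      case/negP: nev; apply/eqP; apply: (@vpos_inj _ _ _ G).
      rewrite -ep /endpoint; move: hy ncb; rewrite /crosses; case: (s) => hy ncb.
        have -> : y0 = bot b by lra.
        by rewrite afun_lo // -surjective_pairing.
      have -> : y0 = top b by lra.
      by rewrite afun_up // -surjective_pairing.
    have [fl|fr] := far b bx.
      near=> d; suff h : afun G b (y0 + sgn R s * d) < x0 - e.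
        by apply/negbTE/negP => /andP[_]; lra.
      near: d; apply: (cvgb [set z | z < x0 - e]).
      exact: (open_nbhs_nbhs (conj (@open_lt _ _) fl)).
    near=> d; suff h : x0 + e < afun G b (y0 + sgn R s * d).
      by apply/negbTE/negP => /andP[_]; lra.
    near: d; apply: (cvgb [set z | x0 + e < z]).
    exact: (open_nbhs_nbhs (conj (@open_gt _ _) fr)).
  have [bt|bt] : (if s then y0 < bot b else y0 > top b)
     \/ (if s then y0 >= top b else y0 <= bot b).
  - case: (s) hy => hy.
      by have [?|?] := ltP y0 (bot b); [left|right; lra].
    by have [?|?] := ltP (top b) y0; [left|right; lra].
  - have [r r0 hr] : exists2 r, 0 < r & forall d, 0 < d -> d < r ->
        ~~ crosses G b (y0 + sgn R s * d).
      exists (if s then bot b - y0 else y0 - top b); first by case: (s) bt => bt; lra.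
      by rewrite /crosses; case: (s) bt => bt d ? ? /=; lra.
    near=> d; have d0 : 0 < d by near: d; exact: nbhs_right_gt.
    have dr : d < r by near: d; exact: nbhs_right_lt.
    by rewrite (negbTE (hr d d0 dr)).
  - near=> d; have d0 : 0 < d by near: d; exact: nbhs_right_gt.
    suff h : ~~ crosses G b (y0 + sgn R s * d) by rewrite (negbTE h).
    by move: bt; rewrite /crosses; case: (s) => /= ?; lra.
near (0 : R)^'+ => d.
have d0 : 0 < d by near: d; exact: nbhs_right_gt.
have d1 : d < r1 by near: d; exact: nbhs_right_lt.
have d2 : d < r2 by near: d; exact: nbhs_right_lt.
have hl w : (vpos G w).2 != y0 + sgn R s * d by move: w; near: d.
have ha b : crosses G b (y0 + sgn R s * d)
    && (x0 - e < afun G b (y0 + sgn R s * d) < x0 + e) = (endpoint s b == v).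
  by move: b; near: d.
(* The ends of the window move vertically back to height [y0] within their faces, which is why the
   value of the sum does not depend on [s]. *)
have vert x r : 0 < r -> d < r -> (forall x' y', x - r < x' < x + r ->
    y0 - r < y' < y0 + r -> ~ carrier G (x', y')) ->
    ~ carrier G (x, y0 + sgn R s * d) /\ face G (x, y0 + sgn R s * d) = face G (x, y0).
  move=> r0 dr hr; split; first by apply: hr; case: (s) => /=; lra.
  apply: (@component_vsegment _ _ _ (y0 - d) (y0 + d)).
  - by move=> u hu; apply: hr; lra.
  - by case: (s) => /=; lra.
  - by lra.
have [ol fl] := vert _ _ r10 d1 hr1.
have [or fr] := vert _ _ r20 d2 hr2.
rewrite -fl -fr -(@sum_jump_between F) //.
- by apply: eq_bigl => b; rewrite ha.
- by move=> /=; lra.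
- by move=> w /eqP; rewrite (negbTE (hl w)).
Unshelve. all: by end_near. Qed.

Lemma jump_vertex_balance F v :
  \sum_(a | aup G a == v) jump F a = \sum_(a | alo G a == v) jump F a.
Proof.
near (0 : R)^'+ => e.
transitivity (is_face F ((vpos G v).1 + e, (vpos G v).2)
    - is_face F ((vpos G v).1 - e, (vpos G v).2)).
  by near: e; exact: (sum_jump_vertex false).
by symmetry; near: e; exact: (sum_jump_vertex true).
Unshelve. all: by end_near. Qed.

End FaceCounting.

(** * Chains of the extended poset *)

Section Chains.
Variables (disp : Order.disp_t) (P : finPOrderType disp).
Implicit Types (u v w z : hat P) (e : hasse_edge P) (c : seq (hasse_edge P)).

Lemma hat_lt_irr u : hat_lt u u = false.
Proof. by case: u => [a|[]] //=; rewrite ltxx. Qed.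

Lemma hat_lt_trans v u w : hat_lt u v -> hat_lt v w -> hat_lt u w.
Proof. by case: u v w => [a|[]] [b|[]] [d|[]] //=; exact: lt_trans. Qed.

Lemma hat0_lt u : u != hat0 P -> hat_lt (hat0 P) u.
Proof. by case: u => [a|[]]. Qed.

Lemma lt_hat1 u : u != hat1 P -> hat_lt u (hat1 P).
Proof. by case: u => [a|[]]. Qed.

Lemma edge_lt e : hat_lt (lower e) (upper e).
Proof. by have /andP[] := valP e. Qed.

Fixpoint chain u c w : Prop :=
  if c is e :: c' then lower e = u /\ chain (upper e) c' w else u = w.

Lemma chain_cat u c1 v c2 w : chain u c1 v -> chain v c2 w -> chain u (c1 ++ c2) w.
Proof.
by elim: c1 u => [u ->|e c1 IH u /= [eu h1] h2] //; split=> //; exact: IH.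
Qed.

(** Induction on the number of elements strictly between [u] and [w]; if there are none, the pair
    itself is an edge. *)
Lemma chain_exists u w : hat_lt u w -> exists c, chain u c w.
Proof.
have [n] := ubnP #|[pred z | hat_lt u z && hat_lt z w]|.
elim: n u w => // n IH u w /ltnSE cn uw.
have [cov|] := boolP (covers u w).
  by exists [:: exist _ (u, w) cov : hasse_edge P].
rewrite /covers uw /= => /forallPn[z]; rewrite negbK => /andP[uz zw].
have [c1 h1] : exists c, chain u c z.
  apply: IH => //; apply: (leq_trans _ cn); apply: proper_card; apply/properP; split.
    apply/fintype.subsetP => t; rewrite !inE => /andP[-> tz].
    exact: hat_lt_trans zw.
  by exists z; rewrite !inE ?uz ?zw // hat_lt_irr.
have [c2 h2] : exists c, chain z c w.
  apply: IH => //; apply: (leq_trans _ cn); apply: proper_card; apply/properP; split.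
    apply/fintype.subsetP => t; rewrite !inE => /andP[zt ->].
    by rewrite (hat_lt_trans uz).
  by exists z; rewrite !inE ?uz ?zw // hat_lt_irr.
by exists (c1 ++ c2); exact: chain_cat h2.
Qed.

Lemma chain_from_hat0 u : exists c, chain (hat0 P) c u.
Proof.
have [->|/hat0_lt/chain_exists//] := eqVneq u (hat0 P); by exists [::].
Qed.

Lemma chain_to_hat1 u : exists c, chain u c (hat1 P).
Proof.
have [->|/lt_hat1/chain_exists//] := eqVneq u (hat1 P); by exists [::].
Qed.

Lemma maximal_chain_through e : exists2 c, chain (hat0 P) c (hat1 P) & e \in c.
Proof.
have [c1 h1] := chain_from_hat0 (lower e); have [c2 h2] := chain_to_hat1 (upper e).
exists (c1 ++ e :: c2); first by apply: chain_cat h1 _.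
by rewrite mem_cat inE eqxx orbT.
Qed.

Lemma chain_telescope (M : zmodType) (X : hat P -> M) u c w : chain u c w ->
  \sum_(e <- c) (X (upper e) - X (lower e)) = X w - X u.
Proof.
elim: c u => [u ->|e c IH u /= [eu h]]; first by rewrite big_nil subrr.
by rewrite big_cons (IH _ h) eu addrC addrA subrK.
Qed.

End Chains.

(** * Upward arcs *)

Section UpwardArcs.
Variable R : realType.

Lemma continuous_clamp (a b : R) : continuous (fun y : R => Num.min (Num.max y a) b).
Proof.
move=> y.
have hm : {for y, continuous ((id : R -> R^o) \max (cst a : R -> R^o))}.
  by apply: continuous_max; [exact: cvg_id | exact: cvg_cst].
exact: (continuous_min hm (cvg_cst (b : R^o))).
Qed.

Lemma continuous_comp_clamp (T : topologicalType) (f : R -> T) (a b : R) : a <= b ->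
  {within `[a, b], continuous f} -> continuous (fun y => f (Num.min (Num.max y a) b)).
Proof.
move=> ab cf.
have hin z : Num.min (Num.max z a) b \in `[a, b].
  by rewrite in_itv /= le_min ab andbT le_max lexx orbT ge_min lexx orbT.
move=> y; have := cf (Num.min (Num.max y a) b).
move=> h U /h hU0.
have hU : within `[a, b] (nbhs (Num.min (Num.max y a) b : R)) (f @^-1` U).
  by rewrite nbhs_subspace_in //; exact: hin.
have : \forall z \near y, Num.min (Num.max z a) b \in `[a, b] ->
  U (f (Num.min (Num.max z a) b)) := @continuous_clamp a b y _ hU.
by apply: filterS => z; apply; exact: hin.
Qed.

(** The height is continuous and strictly increasing in the parameter, so it has a continuous
    inverse [T] on [[p.2, q.2]]; [h] reads off the abscissa at [T] after clamping the height to that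
    interval. *)
Lemma upward_arc_graph (p q : R * R) (g : R -> R * R) : upward_arc p q g ->
  exists h : R -> R, [/\ continuous h, p.2 < q.2,
    (forall y, y <= p.2 -> h y = p.1), (forall y, q.2 <= y -> h y = q.1)
  & (forall t, t \in `[0, 1] -> p.2 <= (g t).2 <= q.2 /\ g t = (h (g t).2, (g t).2))
   /\ ((forall y, p.2 < y < q.2 -> exists2 t, t \in `]0, 1[ & g t = (h y, y))
   /\ (forall t, t \in `]0, 1[ -> p.2 < (g t).2 < q.2))].
Proof.
move=> [cg g0 g1 mono].
pose Y t := (g t).2.
have in0 : (0 : R) \in `[0, 1] by rewrite in_itv /= lexx ler01.
have in1 : (1 : R) \in `[0, 1] by rewrite in_itv /= lexx ler01.
have cY : {within `[0, 1], continuous Y}.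
  by move=> t; apply: (@cvg_comp _ _ _ g snd _ _ _ (cg t)); exact: cvg_snd.
have cX : {within `[0, 1], continuous (fun t => (g t).1)}.
  by move=> t; apply: (@cvg_comp _ _ _ g fst _ _ _ (cg t)); exact: cvg_fst.
have Y0 : Y 0 = p.2 by rewrite /Y g0.
have Y1 : Y 1 = q.2 by rewrite /Y g1.
have le : {in `[0, 1] &, {mono Y : s t / s <= t}} by apply: le_mono_in.
have pq : p.2 < q.2 by rewrite -Y0 -Y1; apply: mono.
have Yinj : {in `[0, 1] &, injective Y} by exact: inc_inj_in.
have surj y : p.2 <= y <= q.2 -> exists t, t \in `[0, 1] /\ Y t = y.
  move=> hy; have [|t ht <-] := @IVT R Y 0 1 y ler01 cY; last by exists t.
  by rewrite Y0 Y1 min_l ?max_r // ltW.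
pose T y := xget 0 [set t | t \in `[0, 1] /\ Y t = y].
have TP y : p.2 <= y <= q.2 -> T y \in `[0, 1] /\ Y (T y) = y.
  by move=> /surj[t ht]; rewrite /T; case: xgetP => [s -> //|/(_ t)[]].
have YK : {in `[0, 1], cancel Y T}.
  move=> t ht; have [|h1 h2] := TP (Y t); last exact: Yinj h2.
  by rewrite -Y0 -Y1 !le // -in_itv.
have cT : {within `[p.2, q.2], continuous T}.
  by rewrite -Y0 -Y1; exact: (segment_can_le_continuous ler01 cY YK).
pose cl y := Num.min (Num.max y p.2) q.2.
have clin y : p.2 <= cl y <= q.2.
  by rewrite /cl le_min (ltW pq) andbT le_max lexx orbT ge_min lexx orbT.
have clid y : p.2 <= y <= q.2 -> cl y = y.
  by move=> /andP[h1 h2]; rewrite /cl max_l // min_l.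
have T0 : T p.2 = 0 by rewrite -Y0 YK.
have T1 : T q.2 = 1 by rewrite -Y1 YK.
exists (fun y => (g (T (cl y))).1); split=> //.
- have cTc := continuous_comp_clamp (ltW pq) cT.
  have cXc := continuous_comp_clamp (@ler01 R) cX.
  have -> : (fun y => (g (T (cl y))).1)
      = (fun t => (g (Num.min (Num.max t 0) 1)).1) \o (fun y => T (cl y)).
    apply/funext => y /=; have [/[!in_itv]/=/andP[t0 t1] _] := TP _ (clin y).
    by rewrite max_l // min_l.
  by move=> y; apply: continuous_comp; [exact: cTc | exact: cXc].
- by move=> y hy; rewrite /cl max_r // min_l ?(ltW pq) // T0 g0.
- by move=> y hy; rewrite /cl min_r ?T1 ?g1 // le_max hy.
- split; [|split].
  + move=> t ht; have hY : p.2 <= Y t <= q.2 by rewrite -Y0 -Y1 !le // -in_itv.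
    by split=> //; rewrite clid // YK // -surjective_pairing.
  + move=> y hy; have hy' : p.2 <= y <= q.2 by case/andP: hy => ? ?; rewrite !ltW.
    have [h1 h2] := TP y hy'; exists (T y).
      rewrite in_itv /= !lt_neqAle; move: h1; rewrite in_itv /= => /andP[-> ->].
      rewrite !andbT; apply/andP; split; apply/eqP => E.
        by move: hy; rewrite -h2 -E Y0 ltxx.
      by move: hy; rewrite -h2 E Y1 ltxx andbF.
    by rewrite clid // [LHS]surjective_pairing -[(g _).2]/(Y _) h2.
  + move=> t; rewrite in_itv /= => /andP[t0 t1]; rewrite -Y0 -Y1.
    have ht : t \in `[0, 1] by rewrite in_itv /= !ltW.
    by rewrite !mono.
Qed.

End UpwardArcs.

(** * The drawing of a Hasse diagram *)

Section HasseGraphDrawing.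
Variables (R : realType) (disp : Order.disp_t) (P : finPOrderType disp).
Variables (D : upward_embedding R P) (S : side_edges D).
Implicit Types (e f : hasse_edge P) (u v w : hat P) (y : R).

(* [inr false] and [inr true] are the left and right side edges. *)
Definition arc_index : finType := (hasse_edge P + bool)%type.

Definition arc_lower (a : arc_index) : hat P :=
  if a is inl e then lower e else hat0 P.
Definition arc_upper (a : arc_index) : hat P :=
  if a is inl e then upper e else hat1 P.
Definition arc_curve (a : arc_index) : R -> R * R :=
  match a with
  | inl e => edge_arc D e
  | inr b => if b then right_edge S else left_edge S
  end.

Lemma arc_curve_upward a :
  upward_arc (pos D (arc_lower a)) (pos D (arc_upper a)) (arc_curve a).
Proof.
case: a => [e|[]] /=; [exact: arc_upward | exact: right_edge_upward | exact: left_edge_upward].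
Qed.

Definition arc_fun a : R -> R := sval (cid (upward_arc_graph (arc_curve_upward a))).

Local Notation bot a := (pos D (arc_lower a)).2.
Local Notation top a := (pos D (arc_upper a)).2.

Lemma arc_fun_continuous a : continuous (arc_fun a).
Proof. by rewrite /arc_fun; case: cid => h /= []. Qed.

Lemma arc_lower_lt_upper a : bot a < top a.
Proof. by case: (upward_arc_graph (arc_curve_upward a)) => h []. Qed.

Lemma arc_fun_lower a y : y <= bot a -> arc_fun a y = (pos D (arc_lower a)).1.
Proof. by rewrite /arc_fun; case: cid => h /= [_ _ /(_ y)]. Qed.

Lemma arc_fun_upper a y : top a <= y -> arc_fun a y = (pos D (arc_upper a)).1.
Proof. by rewrite /arc_fun; case: cid => h /= [_ _ _ /(_ y)]. Qed.

Lemma arc_curveE a t : t \in `[0, 1] ->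
  bot a <= (arc_curve a t).2 <= top a
  /\ arc_curve a t = (arc_fun a (arc_curve a t).2, (arc_curve a t).2).
Proof. by rewrite /arc_fun; case: cid => h /= [_ _ _ _ [/(_ t)]]. Qed.

Lemma arc_curve_interior a y : bot a < y < top a ->
  exists2 t, t \in `]0, 1[ & arc_curve a t = (arc_fun a y, y).
Proof. by rewrite /arc_fun; case: cid => h /= [_ _ _ _ [_ [/(_ y)]]]. Qed.

Lemma arc_curve_level a t : t \in `]0, 1[ -> bot a < (arc_curve a t).2 < top a.
Proof. by case: (upward_arc_graph (arc_curve_upward a)) => h [_ _ _ _ [_ [_ /(_ t)]]]. Qed.

Lemma arc_curve_spans a y : bot a <= y <= top a ->
  exists2 t, t \in `[0, 1] & arc_curve a t = (arc_fun a y, y).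
Proof.
have [_ g0 g1 _] := arc_curve_upward a.
move=> /andP[]; rewrite le_eqVlt => /orP[/eqP <- _|h1].
  by exists 0; rewrite ?in_itv /= ?lexx ?ler01 // g0 arc_fun_lower // -surjective_pairing.
rewrite le_eqVlt => /orP[/eqP ->|h2].
  by exists 1; rewrite ?in_itv /= ?lexx ?ler01 // g1 arc_fun_upper // -surjective_pairing.
have [|t ht gt] := @arc_curve_interior a y; first by rewrite h1.
by exists t => //; move: ht; rewrite !in_itv /= => /andP[? ?]; rewrite !ltW.
Qed.

Lemma trace_arc a p :
  trace (arc_curve a) p <-> (bot a <= p.2 <= top a /\ p.1 = arc_fun a p.2).
Proof.
split=> [[t /= ht <-]|[h1 h2]].
  by have [h1 h2] := arc_curveE a ht; split=> //; rewrite {1}h2.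
have [t ht gt] := arc_curve_spans h1; exists t => //=.
by rewrite gt -h2 -surjective_pairing.
Qed.

Lemma chain_level u c w : chain u c w ->
  (pos D u).2 <= (pos D w).2 ?= iff (c == [::]).
Proof.
elim: c u => [u <-|e c IH u /= [<- /IH[h _]]]; first by split; rewrite ?eqxx.
have lt := arc_lower_lt_upper (inl e); rewrite /= in lt.
have lt2 := lt_le_trans lt h.
by split; rewrite ?ltW // lt_eqF.
Qed.

Lemma hat_lt_level u w : hat_lt u w -> (pos D u).2 < (pos D w).2.
Proof.
move=> uw; have [c hc] := chain_exists uw.
have := chain_level hc; case: c hc => [/= e|e c _ h]; last by rewrite (lt_leif h).
by rewrite e hat_lt_irr in uw.
Qed.

(** The half-open height intervals of consecutive edges tile that of the chain. *)
Lemma chain_cover u c w y : chain u c w -> (pos D u).2 < y <= (pos D w).2 ->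
  exists2 e, e \in c & (pos D (lower e)).2 < y <= (pos D (upper e)).2.
Proof.
elim: c u => [u <-|e c IH u /= [<- hc] /andP[h1 h2]].
  by case/andP => h1; rewrite leNgt h1.
have [ye|ey] := leP y (pos D (upper e)).2.
  by exists e; rewrite ?inE ?eqxx ?h1.
have [|f fc hf] := IH _ hc; first by rewrite ey.
by exists f; rewrite // inE fc orbT.
Qed.

Lemma level_cover y : (pos D (hat0 P)).2 < y < (pos D (hat1 P)).2 ->
  exists e, (pos D (lower e)).2 < y <= (pos D (upper e)).2.
Proof.
have [c hc] := chain_from_hat0 (hat1 P).
move=> /andP[h1 h2]; have [|e _ he] := chain_cover (y := y) hc; first by rewrite h1 ltW.
by exists e.
Qed.

Lemma vertex_level v : (pos D (hat0 P)).2 <= (pos D v).2 <= (pos D (hat1 P)).2.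
Proof.
apply/andP; split.
  by have [->//|/hat0_lt/hat_lt_level/ltW] := eqVneq v (hat0 P).
by have [->//|/lt_hat1/hat_lt_level/ltW] := eqVneq v (hat1 P).
Qed.

(** A side edge reaches every height strictly between bottom and top, so its passing beside [q]
    becomes an inequality of abscissas at the height of [q]. The height condition excludes the two
    points where side edges meet the diagram. *)
Lemma side_arc_beside b q : hasse_drawing D q ->
  (pos D (hat0 P)).2 < q.2 < (pos D (hat1 P)).2 ->
  if b then q.1 < arc_fun (inr b) q.2 else arc_fun (inr b) q.2 < q.1.
Proof.
move=> hq hl.
have n0 : q <> pos D (hat0 P) by move=> e; move: hl; rewrite e ltxx.
have n1 : q <> pos D (hat1 P) by move=> e; move: hl; rewrite e ltxx andbF.
have [t ht gt] := @arc_curve_interior (inr b) q.2 hl.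
have ht' : t \in `[0, 1] by move: ht; rewrite !in_itv /= => /andP[? ?]; rewrite !ltW.
case: b gt => /= gt.
  by have := @right_edge_passes _ _ _ _ S q hq n0 n1 t ht'; rewrite gt; apply.
by have := @left_edge_passes _ _ _ _ S q hq n0 n1 t ht'; rewrite gt; apply.
Qed.

Lemma hasse_edge_drawing e y :
  (pos D (lower e)).2 <= y <= (pos D (upper e)).2 -> hasse_drawing D (arc_fun (inl e) y, y).
Proof. by move=> h; right; exists e => //; apply/(trace_arc (inl e)). Qed.

Lemma arc_level a y : bot a < y < top a -> (pos D (hat0 P)).2 < y < (pos D (hat1 P)).2.
Proof.
have /andP[h1 _] := vertex_level (arc_lower a); have /andP[_ h2] := vertex_level (arc_upper a).
by move=> /andP[? ?]; rewrite (le_lt_trans h1) // (lt_le_trans _ h2).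
Qed.

Lemma arc_fun_avoids_vertices a v y : bot a < y < top a -> (arc_fun a y, y) <> pos D v.
Proof.
move=> hy; have [t ht gt] := arc_curve_interior hy.
case: a hy gt => [e|b] hy gt; first by rewrite -gt; exact: arc_avoids_vertices.
move=> e; have hv : hasse_drawing D (pos D v) by left; exists v.
have := side_arc_beside b hv; rewrite -e /= => /(_ (arc_level hy)).
by case: ifP => _; rewrite ltxx.
Qed.

(** The side edges are only placed relative to the diagram, but at every inner height some Hasse
    edge lies between them. *)
Lemma side_arcs_apart y : (pos D (hat0 P)).2 < y < (pos D (hat1 P)).2 ->
  arc_fun (inr false) y < arc_fun (inr true) y.
Proof.
move=> hy; have [e /andP[/ltW h1 h2]] := level_cover hy.
have hq : hasse_drawing D (arc_fun (inl e) y, y) by apply: hasse_edge_drawing; rewrite h1.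
exact: lt_trans (side_arc_beside false hq hy) (side_arc_beside true hq hy).
Qed.

Lemma arc_fun_avoids_arcs a b y : a != b ->
  bot a < y < top a -> bot b <= y <= top b -> arc_fun a y != arc_fun b y.
Proof.
move=> ab ha hb; have hl := arc_level ha.
case: a b ab ha hb => [e|s] [f|r] ab ha hb.
- apply/eqP => E; have [t ht gt] := @arc_curve_interior (inl e) y ha.
  apply: (@arc_avoids_arcs _ _ _ D e f t ht); first by move=> ef; rewrite ef eqxx in ab.
  by apply/(trace_arc (inl f)); rewrite [edge_arc D e t]gt.
- have /andP[h1 h2] := ha.
  have hq : hasse_drawing D (arc_fun (inl e) y, y) by apply: hasse_edge_drawing; rewrite !ltW.
  by have := side_arc_beside r hq hl; case: (r) => /= h; [rewrite lt_eqF|rewrite gt_eqF].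
- have hq := hasse_edge_drawing hb.
  by have := side_arc_beside s hq hl; case: (s) => /= h; [rewrite gt_eqF|rewrite lt_eqF].
- have := side_arcs_apart hl.
  by case: s r ab {ha hb} => [] [] //= _ h; [rewrite gt_eqF|rewrite lt_eqF].
Qed.

Definition hasse_graph : graph_drawing R (hat P) arc_index :=
  GraphDrawing (@pos_inj _ _ _ D) arc_lower_lt_upper arc_fun_continuous
    arc_fun_lower arc_fun_upper arc_fun_avoids_vertices arc_fun_avoids_arcs.

Lemma carrier_hasse_graph : carrier hasse_graph = drawing S.
Proof.
apply/seteqP; split=> p.
  case=> [[v ->]|[a h1 h2]]; first by left; left; left; exists v.
  have : trace (arc_curve a) p by apply/trace_arc.
  case: a {h1 h2} => [e|[]] /= h; [|by right|by left; right].
  by left; left; right; exists e.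
case=> [[[[v _ <-]|[e _ h]]|h]|h]; first by left; exists v.
- by right; exists (inl e); have /(trace_arc (inl e))[] := h.
- by right; exists (inr false); have /(trace_arc (inr false))[] := h.
- by right; exists (inr true); have /(trace_arc (inr true))[] := h.
Qed.

Lemma face_hasse_graph : face hasse_graph = face_of S.
Proof. by apply/funext => p; rewrite /face carrier_hasse_graph. Qed.

Lemma midpoint_level a : bot a < (bot a + top a) / 2 < top a.
Proof. by have := arc_lower_lt_upper a; lra. Qed.

(** [left_face] asks for membership at every interior point of the arc; by [side_atE] each of these
    points alone yields the same face. *)
Lemma left_face_side a : left_face S (arc_curve a) = side hasse_graph false a.
Proof.
have E t : t \in `]0, 1[ ->
    [set p | \forall eps \near 0^'+, face_of S ((arc_curve a t).1 - eps, (arc_curve a t).2) p]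
    = side hasse_graph false a.
  move=> ht; have hl := arc_curve_level a ht.
  have ht' : t \in `[0, 1] by move: ht; rewrite !in_itv /= => /andP[? ?]; rewrite !ltW.
  have [_ gt] := arc_curveE a ht'.
  rewrite -(side_atE (G := hasse_graph) (a := a) false hl) /side_at face_hasse_graph /=.
  have -> : (arc_curve a t).1 = arc_fun a (arc_curve a t).2 by rewrite {1}gt.
  by apply/seteqP; split=> p; apply: filterS => eps /=; rewrite mulN1r.
have [t ht _] := arc_curve_interior (midpoint_level a).
apply/seteqP; split=> p hp; first by rewrite -(E t ht); exact: hp.
by move=> s hs; rewrite -(E s hs) in hp.
Qed.

Lemma right_face_side a : right_face S (arc_curve a) = side hasse_graph true a.
Proof.
have E t : t \in `]0, 1[ ->
    [set p | \forall eps \near 0^'+, face_of S ((arc_curve a t).1 + eps, (arc_curve a t).2) p]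
    = side hasse_graph true a.
  move=> ht; have hl := arc_curve_level a ht.
  have ht' : t \in `[0, 1] by move: ht; rewrite !in_itv /= => /andP[? ?]; rewrite !ltW.
  have [_ gt] := arc_curveE a ht'.
  rewrite -(side_atE (G := hasse_graph) (a := a) true hl) /side_at face_hasse_graph /=.
  have -> : (arc_curve a t).1 = arc_fun a (arc_curve a t).2 by rewrite {1}gt.
  by apply/seteqP; split=> p; apply: filterS => eps /=; rewrite mul1r.
have [t ht _] := arc_curve_interior (midpoint_level a).
apply/seteqP; split=> p hp; first by rewrite -(E t ht); exact: hp.
by move=> s hs; rewrite -(E s hs) in hp.
Qed.

End HasseGraphDrawing.

(** * The two sides of a maximal chain *)

Section ChainSides.
Variables (R : realType) (disp : Order.disp_t) (P : finPOrderType disp).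
Variables (D : upward_embedding R P) (S : side_edges D).
Implicit Types (e f : hasse_edge P) (u v w : hat P) (y : R) (c : seq (hasse_edge P)).

Local Notation G := (hasse_graph S).
Local Notation y0 := (pos D (hat0 P)).2.
Local Notation y1 := (pos D (hat1 P)).2.
Local Notation efun e := (arc_fun S (inl e)).
Local Notation sfun b := (arc_fun S (inr b)).

(* The chain [c] from [u], as a graph over the heights: since each [efun e] is
   constant outside its arc, the increments of the arcs simply add up. *)
Definition chain_fun u c y : R :=
  (pos D u).1 + \sum_(e <- c) (efun e y - (pos D (lower e)).1).

Lemma chain_fun_continuous u c : continuous (chain_fun u c).
Proof.
move=> y; apply: cvgD; first exact: cvg_cst.
elim: c => [|e c IH].
  under eq_fun do rewrite big_nil; rewrite big_nil; exact: cvg_cst.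
under eq_fun do rewrite big_cons; rewrite big_cons.
apply: cvgD => //; apply: cvgB; [exact: arc_fun_continuous | exact: cvg_cst].
Qed.

Lemma chain_mem_level u c w e : chain u c w -> e \in c ->
  (pos D u).2 <= (pos D (lower e)).2.
Proof.
elim: c u => [//|f c IH u /= [<- hc]]; rewrite inE => /predU1P[->//|ec].
apply: le_trans (IH _ hc ec); apply: ltW; exact: (arc_lower_lt_upper S (inl f)).
Qed.

(** The heights of the lower ends strictly increase along a chain. *)
Lemma chain_uniq u c w : chain u c w -> uniq c.
Proof.
elim: c u => [//|e c IH u /= [_ hc]]; rewrite (IH _ hc) andbT.
apply/negP => /(chain_mem_level hc); rewrite leNgt.
by rewrite (arc_lower_lt_upper S (inl e)).
Qed.

Lemma chain_fun_start u c w y : chain u c w -> y <= (pos D u).2 ->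
  chain_fun u c y = (pos D u).1.
Proof.
move=> hc hy; rewrite /chain_fun big_seq big1 ?addr0 // => e ec.
by rewrite arc_fun_lower ?subrr //; apply: le_trans (chain_mem_level hc ec).
Qed.

Lemma chain_fun_cons u e c y : lower e = u -> (pos D (upper e)).2 <= y ->
  chain_fun u (e :: c) y = chain_fun (upper e) c y.
Proof.
move=> <- hy; rewrite /chain_fun big_cons [efun e y]arc_fun_upper //=.
by rewrite addrA [X in X + _]addrC subrK.
Qed.

Lemma chain_fun_end u c w y : chain u c w -> (pos D w).2 <= y ->
  chain_fun u c y = (pos D w).1.
Proof.
elim: c u => [u <- _|e c IH u /= [eu hc] hy]; first by rewrite /chain_fun big_nil addr0.
rewrite chain_fun_cons // ?(IH _ hc) //.
by have [h _] := chain_level S hc; exact: le_trans h hy.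
Qed.

(** At such a height the edges before [e] have contributed their full increments and those after it
    nothing. *)
Lemma chain_fun_edge u c w e y : chain u c w -> e \in c ->
  (pos D (lower e)).2 < y <= (pos D (upper e)).2 -> chain_fun u c y = efun e y.
Proof.
elim: c u => [//|f c IH u /= [fu hc]]; rewrite inE.
move=> /predU1P[-> /andP[h1 h2]|ec /andP[h1 h2]].
  have := chain_fun_start hc h2; rewrite /chain_fun big_cons -fu.
  by move=> /eqP; rewrite -subr_eq0 addrAC subrr add0r => /eqP ->; rewrite addr0 addrC subrK.
rewrite chain_fun_cons // ?(IH _ hc) ?h1 //.
by apply: le_trans (ltW h1); exact: (chain_mem_level hc ec).
Qed.

(* The part of the strip between the side edges on the right of [c] if [s], on
   its left otherwise. *)
Definition chain_region (s : bool) c : set (R * R) :=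
  [set q | y0 < q.2 < y1
    /\ if s then chain_fun (hat0 P) c q.2 < q.1 < sfun true q.2
       else sfun false q.2 < q.1 < chain_fun (hat0 P) c q.2].

Lemma chain_region_disjoint s c q : chain_region s c q -> ~ chain_region (~~ s) c q.
Proof.
by move=> [_ h1] [_]; case: s h1 => /= /andP[a b] /andP[a' b'];
  [have := lt_trans a b' | have := lt_trans a' b]; rewrite ltxx.
Qed.

Variable c : seq (hasse_edge P).
Hypothesis hc : chain (hat0 P) c (hat1 P).

Local Notation C := (chain_fun (hat0 P) c).

Lemma y0_lt_y1 : y0 < y1.
Proof. exact: (arc_lower_lt_upper S (inr true)). Qed.

Lemma chain_carrier y : y0 <= y <= y1 -> carrier G (C y, y).
Proof.
move=> /andP[]; rewrite le_eqVlt => /orP[/eqP <- _|h1 h2].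
  by left; exists (hat0 P); rewrite (chain_fun_start hc) // -surjective_pairing.
have [|e ec /andP[b1 b2]] := chain_cover (D := D) (y := y) hc; first by rewrite h1.
right; exists (inl e); first by rewrite /spans /= (ltW b1).
by rewrite /= (chain_fun_edge hc ec) // b1.
Qed.

Lemma side_carrier b y : y0 <= y <= y1 -> carrier G (sfun b y, y).
Proof. by move=> hy; right; exists (inr b). Qed.

Lemma chain_between_sides y : y0 < y < y1 -> sfun false y < C y < sfun true y.
Proof.
move=> hy; have /andP[h1 h2] := hy.
have [|e ec /andP[b1 b2]] := chain_cover (D := D) (y := y) hc; first by rewrite h1 ltW.
have hq : hasse_drawing D (efun e y, y) by apply: hasse_edge_drawing; rewrite (ltW b1).
rewrite (chain_fun_edge hc ec) ?b1 //.
by rewrite (side_arc_beside S false hq hy) (side_arc_beside S true hq hy).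
Qed.

(** The chain and the side edge that bound the region belong to the drawing and meet at bottom and
    top, so [component_between_graphs] applies. *)
Lemma face_sub_region s p : ~ carrier G p -> chain_region s c p ->
  face G p `<=` chain_region s c.
Proof.
have l := y0_lt_y1.
have c0 : C y0 = (pos D (hat0 P)).1 by exact: (chain_fun_start hc).
have c1 : C y1 = (pos D (hat1 P)).1 by exact: (chain_fun_end hc).
have s0 b : sfun b y0 = (pos D (hat0 P)).1 by exact: (@arc_fun_lower _ _ _ _ S (inr b)).
have s1 b : sfun b y1 = (pos D (hat1 P)).1 by exact: (@arc_fun_upper _ _ _ _ S (inr b)).
move=> np [hp1 hp2]; rewrite /face /chain_region.
case: s hp2 => hp2; apply: component_between_graphs => //.
all: try exact: chain_fun_continuous.
all: try exact: arc_fun_continuous.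
all: rewrite ?c0 ?c1 ?s0 ?s1 ?(ltW l) //.
all: move=> y hy /=; rewrite notK; first [exact: chain_carrier | exact: side_carrier].
Qed.

(** Locating the points close to [a] at a single height is enough to locate the whole face beside
    it. *)
Lemma side_sub_region r s a y : crosses G a y ->
  (\forall eps \near 0^'+, chain_region s c (arc_fun S a y + sgn R r * eps, y)) ->
  exists p, [/\ ~ carrier G p, side G r a = face G p, face G p p
    & face G p `<=` chain_region s c].
Proof.
move=> ca hr; near (0 : R)^'+ => e.
have [n1 n2] : ~ carrier G (arc_fun S a y + sgn R r * e, y)
    /\ side G r a = face G (arc_fun S a y + sgn R r * e, y).
  by near: e; exact: near_side.
exists (arc_fun S a y + sgn R r * e, y); split=> //.
  exact: connected_component_refl.
by apply: face_sub_region => //; near: e.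
Unshelve. all: by end_near. Qed.

Lemma edge_crosses (e : hasse_edge P) : crosses G (inl e)
  (((pos D (lower e)).2 + (pos D (upper e)).2) / 2).
Proof. exact: (midpoint_level S (inl e)). Qed.

Lemma side_edge_in_chain r e : e \in c -> exists p, [/\ ~ carrier G p,
  side G r (inl e) = face G p, face G p p & face G p `<=` chain_region r c].
Proof.
move=> ec; have ce := edge_crosses e; apply: (side_sub_region ce).
move: ce; set y := (_ / 2) => ce.
have hl : y0 < y < y1 := arc_level S ce.
have /andP[h1 h2] := chain_between_sides hl.
have cE : C y = efun e y.
  by case/andP: ce => b1 b2; apply: (chain_fun_edge hc ec); rewrite b1 ltW.
near=> d; have d0 : 0 < d by near: d; exact: nbhs_right_gt.
have d1 : d < sfun true y - C y by near: d; apply: nbhs_right_lt; lra.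
have d2 : d < C y - sfun false y by near: d; apply: nbhs_right_lt; lra.
by split=> //=; rewrite -cE; case: (r) => /=; lra.
Unshelve. all: by end_near. Qed.

(** The edge misses the chain at its mid height, and the comparison there decides [s] for the points
    close to the edge on either side of it. *)
Lemma side_edge_off_chain e : e \notin c -> exists s, forall r, exists p,
  [/\ ~ carrier G p, side G r (inl e) = face G p, face G p p
    & face G p `<=` chain_region s c].
Proof.
move=> ec; have ce := edge_crosses e; move: ce; set y := (_ / 2) => ce.
have hl : y0 < y < y1 := arc_level S ce.
have /andP[h1 h2] := hl.
have /andP[b1 b2] := ce.
have hq : hasse_drawing D (efun e y, y) by apply: hasse_edge_drawing; rewrite !ltW.
have k1 := side_arc_beside S false hq hl; have k2 := side_arc_beside S true hq hl.
rewrite /= in k1 k2.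
have ne : efun e y != C y.
  have [|f fc /andP[c1 c2]] := chain_cover (D := D) (y := y) hc; first by rewrite h1 ltW.
  rewrite (chain_fun_edge hc fc) ?c1 //; apply: arc_fun_avoids_arcs => //.
    by apply: contra ec => /eqP[->].
  by rewrite (ltW c1).
exists (C y < efun e y) => r; apply: (side_sub_region ce).
have [lt|lt|eq] := ltgtP (efun e y) (C y); last by rewrite eq eqxx in ne.
- near=> d; have d0 : 0 < d by near: d; exact: nbhs_right_gt.
  have d1 : d < C y - efun e y by near: d; apply: nbhs_right_lt; lra.
  have d2 : d < efun e y - sfun false y by near: d; apply: nbhs_right_lt; lra.
  by split=> //=; case: (r) => /=; lra.
- near=> d; have d0 : 0 < d by near: d; exact: nbhs_right_gt.
  have d1 : d < efun e y - C y by near: d; apply: nbhs_right_lt; lra.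
  have d2 : d < sfun true y - efun e y by near: d; apply: nbhs_right_lt; lra.
  by split=> //=; case: (r) => /=; lra.
Unshelve. all: by end_near. Qed.

(** [~~ b] selects the inner side: the right of the left edge and the left of the right one, which
    are the source and the sink of the dual. *)
Lemma side_side_edge b : exists p, [/\ ~ carrier G p,
  side G (~~ b) (inr b) = face G p, face G p p & face G p `<=` chain_region b c].
Proof.
have ce : crosses G (inr b) ((y0 + y1) / 2) by exact: (midpoint_level S (inr b)).
apply: (side_sub_region ce); move: ce; set y := (_ / 2) => ce.
have hl : y0 < y < y1 := ce.
have /andP[h1 h2] := chain_between_sides hl.
near=> d; have d0 : 0 < d by near: d; exact: nbhs_right_gt.
have d1 : d < sfun true y - C y by near: d; apply: nbhs_right_lt; lra.
have d2 : d < C y - sfun false y by near: d; apply: nbhs_right_lt; lra.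
by split=> //=; case: (b) => /=; lra.
Unshelve. all: by end_near. Qed.

(** Abscissas in the region are squeezed between the least one on the left edge and the greatest one
    on the right edge, both attained by compactness. *)
Lemma chain_region_bounded s : bounded_set (chain_region s c).
Proof.
have l := ltW y0_lt_y1.
have [z1 _ m1] := EVT_min l (continuous_subspaceT (@arc_fun_continuous _ _ _ _ S (inr false))).
have [z2 _ m2] := EVT_max l (continuous_subspaceT (@arc_fun_continuous _ _ _ _ S (inr true))).
set M := `|sfun false z1| + `|sfun true z2| + `|y0| + `|y1|.
exists M; split; first exact: num_real.
move=> x Mx q [hq1 hq2] /=.
have hy : q.2 \in `[y0, y1] by rewrite in_itv /=; case/andP: hq1 => ? ?; rewrite !ltW.
have := m1 _ hy; have := m2 _ hy => k2 k1.
have /andP[c1 c2] := chain_between_sides hq1.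
have := ler_norm (sfun false z1); have := ler_norm (sfun true z2).
have := ler_norm y0; have := ler_norm y1.
have := ler_norm (- sfun false z1); have := ler_norm (- sfun true z2).
have := ler_norm (- y0); have := ler_norm (- y1); rewrite !normrN => *.
rewrite ltW // prod_normE gt_max !ltr_norml.
by case: s hq2 => /= hq2; apply/andP; split; move: Mx; rewrite /M; lra.
Qed.

End ChainSides.

(** * Relative volume *)

Section AffineVolume.
Variables (R : realType) (I J : finType).
Variable phi : {ffun I -> R^o} -> {ffun J -> R^o}.
Hypothesis phi_affine : affine_map phi.

Lemma affine_span_image (A : set {ffun I -> R^o}) :
  affine_span (phi @` A) = phi @` affine_span A.
Proof.
have [l [c phiE]] := phi_affine.
have comb n (s : 'I_n -> {ffun I -> R^o}) (w : 'I_n -> R) : \sum_j w j = 1 ->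
    \sum_j w j *: phi (s j) = phi (\sum_j w j *: s j).
  move=> w1; rewrite phiE linear_sum -[c in RHS]scale1r -w1 scaler_suml -big_split /=.
  by apply: eq_bigr => j _; rewrite phiE linearZ scalerDr.
apply/seteqP; split=> x.
  move=> [n [p [w [hp w1 ->]]]].
  have /choice[s sP] j : exists s, A s /\ phi s = p j by have [s ? ?] := hp j; exists s.
  exists (\sum_j w j *: s j).
    by exists n, s, w; split=> // j; have [] := sP j.
  by rewrite -comb //; apply: eq_bigr => j _; have [_ ->] := sP j.
move=> [_ [n [s [w [hs w1 ->]]]] <-].
exists n, (phi \o s), w; split=> //; last by rewrite -comb.
by move=> j; exists (s j).
Qed.

Hypothesis phi_inj : injective phi.
Hypothesis phi_integral : forall x, integral_point (phi x) <-> integral_point x.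

(* [phi] carries the lattice frames of [S] bijectively onto those of its image,
   so both volumes are selected from the same set. *)
Lemma relative_volume_image (S A : set {ffun I -> R^o}) :
  relative_volume (phi @` S) (phi @` A) = relative_volume S A.
Proof.
have [l [c phiE]] := phi_affine.
have frameE d o (b : 'I_d -> {ffun I -> R^o}) z :
    frame_point (phi o) (fun j => l (b j)) z = phi (frame_point o b z).
  rewrite /frame_point !phiE linearD linear_sum addrAC; congr (_ + _ + _).
  by apply: eq_bigr => j _; rewrite linearZ.
have preE d o (b : 'I_d -> {ffun I -> R^o}) :
    frame_point (phi o) (fun j => l (b j)) @^-1` (phi @` A) = frame_point o b @^-1` A.
  apply/seteqP; split=> z /=; rewrite frameE; first by move=> [x Ax /phi_inj <-].
  by move=> h; exists (frame_point o b z).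
have rangeE d o (b : 'I_d -> {ffun I -> R^o}) :
    range (frame_point (phi o) (fun j => l (b j))) = phi @` range (frame_point o b).
  apply/seteqP; split=> z.
    by move=> [t _ <-]; rewrite frameE; exists (frame_point o b t) => //; exists t.
  by move=> [_ [t _ <-] <-]; exists t; rewrite ?frameE.
have frames d o (b : 'I_d -> {ffun I -> R^o}) :
    lattice_frame (phi @` S) (phi o) (fun j => l (b j)) <-> lattice_frame S o b.
  rewrite /lattice_frame rangeE affine_span_image; split=> -[h1 h2 h3]; split.
  - apply/seteqP; split=> z hz.
      have : (phi @` affine_span S) (phi z) by rewrite -h1; exists z.
      by move=> [t ht /phi_inj <-].
    have : (phi @` range (frame_point o b)) (phi z) by rewrite h1; exists z.
    by move=> [t ht /phi_inj <-].
  - by move=> z t e; apply: h2; rewrite !frameE e.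
  - by move=> z; rewrite -h3 frameE phi_integral.
  - by rewrite h1.
  - by move=> z t; rewrite !frameE => /phi_inj/h2.
  - by move=> z; rewrite frameE phi_integral h3.
rewrite /relative_volume; congr xget; apply/seteqP; split=> v.
  (* A frame of the image has to be pulled back. Its origin, and the origin plus each basis vector,
     are frame points and hence values of [phi]; their preimages supply the origin and, by
     differences, the basis. *)
  move=> [d [p1 [b1 [hf ->]]]].
  have [hr _ _] := hf; rewrite affine_span_image in hr.
  have hpre z : exists t, phi t = frame_point p1 b1 z.
    have [t _ <-] : (phi @` affine_span S) (frame_point p1 b1 z) by rewrite -hr; exists z.
    by exists t.
  have frame0 : frame_point p1 b1 0 = p1.
    by rewrite /frame_point big1 ?addr0 // => j _; rewrite ffunE scale0r.
  have frame1 k : frame_point p1 b1 [ffun j => (j == k)%:R] = p1 + b1 k.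
    rewrite /frame_point (bigD1 k) //= big1 => [|j jk]; rewrite ffunE.
      by rewrite eqxx scale1r addr0.
    by rewrite (negbTE jk) scale0r.
  have [q qE] := hpre 0; rewrite frame0 in qE.
  have /choice[b bE] k : exists t, phi (q + t) = p1 + b1 k.
    have [t tE] := hpre [ffun j => (j == k)%:R]; exists (t - q).
    by rewrite addrC subrK tE frame1.
  have b1E : b1 = fun k => l (b k).
    apply/funext => k; apply: (addrI p1); rewrite -bE -qE !phiE linearD.
    by rewrite addrAC.
  rewrite -{}qE {}b1E in hf *.
  by exists d, q, b; split; [apply/frames | rewrite preE].
move=> [d [p [b [hf ->]]]].
by exists d, (phi p), (fun j => l (b j)); split; [apply/frames | rewrite preE].
Qed.

End AffineVolume.

(** * Faces of the truncated dual *)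

Section DualFlows.
Variables (R : realType) (disp : Order.disp_t) (P : finPOrderType disp).
Variables (D : upward_embedding R P) (S : side_edges D).
Implicit Types (e : hasse_edge P) (c : seq (hasse_edge P)) (F : set (R * R)).

Local Notation G := (hasse_graph S).
Local Notation y0 := (pos D (hat0 P)).2.
Local Notation y1 := (pos D (hat1 P)).2.
Local Notation sfun b := (arc_fun S (inr b)).
Local Notation sideL e := (side G false (inl e)).
Local Notation sideR e := (side G true (inl e)).
Local Notation source := (side G true (inr false)).
Local Notation sink := (side G false (inr true)).

Lemma left_faceE e : left_face S (edge_arc D e) = sideL e.
Proof. exact: (left_face_side S (inl e)). Qed.

Lemma right_faceE e : right_face S (edge_arc D e) = sideR e.
Proof. exact: (right_face_side S (inl e)). Qed.

Lemma leftmost_faceE : leftmost_face S = source.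
Proof. exact: (right_face_side S (inr false)). Qed.

Lemma rightmost_faceE : rightmost_face S = sink.
Proof. exact: (left_face_side S (inr true)). Qed.

Lemma bounded_face_in_region s c p : chain (hat0 P) c (hat1 P) ->
  ~ carrier G p -> face G p `<=` chain_region S s c -> bounded_face S (face G p).
Proof.
move=> hc np sub; split.
  by exists p; rewrite ?face_hasse_graph // -carrier_hasse_graph.
have [M [Mr hM]] := chain_region_bounded S hc s.
by exists M; split=> // x Mx q Fq; apply: (hM x Mx); exact: sub.
Qed.

Lemma side_bounded r e : bounded_face S (side G r (inl e)).
Proof.
have [c hc ec] := maximal_chain_through e.
by have [p [np -> _ sub]] := side_edge_in_chain S hc r ec; exact: bounded_face_in_region sub.
Qed.

Lemma side_side_edge_bounded b : bounded_face S (side G (~~ b) (inr b)).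
Proof.
have [c hc] := chain_from_hat0 (hat1 P).
by have [p [np -> _ sub]] := side_side_edge S hc b; exact: bounded_face_in_region sub.
Qed.

(** Nonemptiness matters: the empty set would lie in both regions. *)
Lemma opposite_regions_neq c F F' :
  F !=set0 -> F `<=` chain_region S false c -> F' `<=` chain_region S true c -> F <> F'.
Proof.
move=> [p Fp] h h' E; apply: (chain_region_disjoint (h p Fp)).
by apply: h'; rewrite -E.
Qed.

Lemma sideL_neq_sideR e : sideL e <> sideR e.
Proof.
have [c hc ec] := maximal_chain_through e.
have [p [_ -> pp sp]] := side_edge_in_chain S hc false ec.
have [q [_ -> _ sq]] := side_edge_in_chain S hc true ec.
by apply: opposite_regions_neq sp sq; exists p.
Qed.

(** Thus no dual edge enters the source. With its mirror image [sideL_neq_sink], the net flow at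
    source and sink reduces to an outflow and an inflow. *)
Lemma source_neq_sideR e : source <> sideR e.
Proof.
have [c hc ec] := maximal_chain_through e.
have [p [_ -> pp sp]] := side_side_edge S hc false.
have [q [_ -> _ sq]] := side_edge_in_chain S hc true ec.
by apply: opposite_regions_neq sp sq; exists p.
Qed.

Lemma sideL_neq_sink e : sideL e <> sink.
Proof.
have [c hc ec] := maximal_chain_through e.
have [p [_ -> pp sp]] := side_edge_in_chain S hc false ec.
have [q [_ -> _ sq]] := side_side_edge S hc true.
by apply: opposite_regions_neq sp sq; exists p.
Qed.

Lemma source_neq_sink : source <> sink.
Proof.
have [c hc] := chain_from_hat0 (hat1 P).
have [p [_ -> pp sp]] := side_side_edge S hc false.
have [q [_ -> _ sq]] := side_side_edge S hc true.
by apply: opposite_regions_neq sp sq; exists p.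
Qed.

Lemma edge_separates e : separates S e.
Proof.
split; rewrite ?left_faceE ?right_faceE; [exact: side_bounded..|exact: sideL_neq_sideR].
Qed.

Lemma outer_off_carrier b y d : y0 < y < y1 -> 0 < d ->
  ~ carrier G (sfun b y + sgn R b * d, y).
Proof.
move=> hy d0.
have off q : hasse_drawing D q -> q.2 = y -> q.1 != sfun b y + sgn R b * d.
  move=> hq E; have := side_arc_beside S b hq; rewrite E => /(_ hy).
  by case: (b) => /= h; apply/eqP; lra.
case=> [[v ev]|[[e|s] /= h1 h2]].
- have hv : hasse_drawing D (pos D v) by left; exists v.
  by have := off _ hv; rewrite -[pos D v]ev /= eqxx => /(_ erefl).
- by have := off _ (hasse_edge_drawing S h1) erefl; rewrite h2 eqxx.
- have := side_arcs_apart S hy.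
  by case: (b) (s) h2 => [] [] /=; lra.
Qed.

(** At an inner height nothing is drawn beyond a side edge, so the outer face contains a horizontal
    ray. *)
Lemma outer_side_unbounded b : ~ bounded_set (side G b (inr b)).
Proof.
have ca : crosses G (inr b) ((y0 + y1) / 2) := midpoint_level S (inr b).
move: ca; set y := (_ / 2) => ca.
have [e e0 sE] : exists2 e, 0 < e & side G b (inr b) = face G (sfun b y + sgn R b * e, y).
  near (0 : R)^'+ => e; exists e; first by near: e; exact: nbhs_right_gt.
  have [_ //] : ~ carrier G (sfun b y + sgn R b * e, y)
    /\ side G b (inr b) = face G (sfun b y + sgn R b * e, y).
  by near: e; exact: (near_side b ca).
have hin d : 0 < d -> side G b (inr b) (sfun b y + sgn R b * d, y).
  move=> d0; rewrite sE.
  have -> : face G (sfun b y + sgn R b * e, y) = face G (sfun b y + sgn R b * d, y).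
    have off z : 0 < z -> ~ carrier G (sfun b y + sgn R b * z, y).
      exact: outer_off_carrier.
    have shift x : sfun b y + sgn R b * (sgn R b * (x - sfun b y)) = x.
      by case: (b) => /=; lra.
    have [ed|de] := leP e d; case: (b) shift off => /= shift off;
      [ apply: (@component_hsegment _ _ _ (sfun true y + 1 * e) (sfun true y + 1 * d))
      | apply: (@component_hsegment _ _ _ (sfun false y + -1 * d) (sfun false y + -1 * e))
      | apply: (@component_hsegment _ _ _ (sfun true y + 1 * d) (sfun true y + 1 * e))
      | apply: (@component_hsegment _ _ _ (sfun false y + -1 * e) (sfun false y + -1 * d)) ];
      try lra; move=> x hx; rewrite -[x]shift; apply: off; lra.
  by apply: connected_component_refl; exact: outer_off_carrier.
move=> /pinfty_ex_gt0[M M0 hM].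
(* At this distance from the side edge the abscissa has absolute value at least [M + 1]. *)
have d0 : 0 < M + 1 + `|sfun b y| by have := normr_ge0 (sfun b y); lra.
have := hM _ (hin _ d0); rewrite /= prod_normE ge_max => /andP[+ _].
rewrite ler_norml; have := ler_norm (sfun b y); have := ler_norm (- sfun b y).
by rewrite normrN; case: (b) => /=; lra.
Unshelve. all: by end_near. Qed.

(* Summation by parts: the coefficient of [X v] vanishes at every vertex. *)
Lemma net_flow_potential (X : hat P -> R) F : bounded_set F ->
  \sum_e (X (upper e) - X (lower e)) * jump G F (inl e)
  = (X (hat1 P) - X (hat0 P)) * (`[< sink = F >]%:R - `[< source = F >]%:R).
Proof.
move=> bF.
have total : \sum_a (X (aup G a) - X (alo G a)) * jump G F a = 0.
  have part (h : arc_index P -> hat P) :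
      \sum_a X (h a) * jump G F a = \sum_v X v * \sum_(a | h a == v) jump G F a.
    rewrite (partition_big h xpredT) //=; apply: eq_bigr => v _.
    by rewrite mulr_sumr; apply: eq_bigr => a /eqP ->.
  under eq_bigr do rewrite mulrBl.
  rewrite sumrB !part -sumrB big1 // => v _.
  by rewrite (jump_vertex_balance G F v) subrr.
rewrite big_sumType /= big_bool /= in total.
(* A bounded [F] is not an outer face, so each side edge jumps only through its inner face. *)
have n b : `[< side G b (inr b) = F >] = false.
  by apply/asboolPn => E; apply: (@outer_side_unbounded b); rewrite E.
move: total; rewrite /jump !n; lra.
Qed.

End DualFlows.

(** * Flows *)

(** The values will be faces, which do not form a finite type; the list [l] stands in for the range
    of [g]. *)
Lemma sum_by_value (R : pzRingType) (I : finType) (T : eqType) (g : I -> T)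
    (l : seq T) (f : I -> R) (w : T -> R) : uniq l -> (forall i, g i \in l) ->
  \sum_i f i * w (g i) = \sum_(t <- l) (\sum_(i | g i == t) f i) * w t.
Proof.
move=> ul gl; under [RHS]eq_bigr do rewrite mulr_suml big_mkcond.
rewrite exchange_big /=; apply: eq_bigr => i _.
rewrite (bigD1_seq (g i)) //= eqxx big1 ?addr0 // => t.
by rewrite eq_sym => /negbTE ->.
Qed.

Section FlowPotential.
Variables (R : realType) (disp : Order.disp_t) (P : finPOrderType disp).
Variables (D : upward_embedding R P) (S : side_edges D).
Implicit Types (e : hasse_edge P) (c : seq (hasse_edge P)) (F : set (R * R)).

Local Notation G := (hasse_graph S).
Local Notation sideL e := (side G false (inl e)).
Local Notation sideR e := (side G true (inl e)).
Local Notation source := (side G true (inr false)).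
Local Notation sink := (side G false (inr true)).

Variable f : hasse_edge P -> R.
Hypothesis f_source : \sum_(e | `[< sideL e = source >]) f e = 1.
Hypothesis f_balance : forall F, bounded_face S F -> F <> source -> F <> sink ->
  \sum_(e | `[< sideR e = F >]) f e = \sum_(e | `[< sideL e = F >]) f e.

(* Summing the balance over the faces on the left of a maximal chain leaves the
   unit leaving the source and the flow through the chain. *)
Lemma maximal_chain_flow c : chain (hat0 P) c (hat1 P) -> \sum_(e <- c) f e = 1.
Proof.
move=> hc.
pose w F : R := `[< F `<=` chain_region S false c >]%:R.
have w_side s F p : F = face G p -> face G p p -> face G p `<=` chain_region S s c ->
    w F = (~~ s)%:R.
  move=> -> pp sub; rewrite /w; case: s sub => sub; last by rewrite asboolT.
  rewrite asboolF // => sub'.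
  exact: (chain_region_disjoint (sub p pp) (sub' p pp)).
have w_source : w source = 1.
  by have [p [_ E pp sub]] := side_side_edge S hc false; rewrite (w_side _ _ _ E pp sub).
have w_sink : w sink = 0.
  by have [p [_ E pp sub]] := side_side_edge S hc true; rewrite (w_side _ _ _ E pp sub).
(* Only an edge of the chain has its two faces on different sides of the chain. *)
have w_edge e : w (sideL e) - w (sideR e) = (e \in c)%:R.
  have [ec|ec] := boolP (e \in c).
    have [p [_ E pp sub]] := side_edge_in_chain S hc false ec.
    have [q [_ E' qq sub']] := side_edge_in_chain S hc true ec.
    by rewrite (w_side _ _ _ E pp sub) (w_side _ _ _ E' qq sub') subr0.
  have [s hs] := side_edge_off_chain S hc ec.
  have [p [_ E pp sub]] := hs false; have [q [_ E' qq sub']] := hs true.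
  by rewrite (w_side _ _ _ E pp sub) (w_side _ _ _ E' qq sub') subrr.
pose l := undup (source :: [seq sideL e | e <- enum {: hasse_edge P}]
  ++ [seq sideR e | e <- enum {: hasse_edge P}]).
have lL e : sideL e \in l.
  by rewrite mem_undup inE mem_cat (map_f (fun e => sideL e)) ?mem_enum ?orbT.
have lR e : sideR e \in l.
  by rewrite mem_undup inE mem_cat (map_f (fun e => sideR e)) ?mem_enum ?orbT.
have ul : uniq l by exact: undup_uniq.
have l_bounded F : F \in l -> bounded_face S F.
  rewrite mem_undup inE mem_cat => /or3P[/eqP ->|/mapP[e _ ->]|/mapP[e _ ->]].
  - exact: (side_side_edge_bounded S false).
  - exact: side_bounded.
  - exact: side_bounded.
have eqE r F : \sum_(e | side G r (inl e) == F) f e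
    = \sum_(e | `[< side G r (inl e) = F >]) f e.
  by apply: eq_bigl => e; apply/eqP/asboolP.
(* By [w_edge] this sum is the flow through the chain; regrouped by faces it is the weighted sum of
   net outflows. *)
transitivity (\sum_e f e * (w (sideL e) - w (sideR e))).
  rewrite (big_uniq _ (chain_uniq S hc)) /= big_mkcond /=; apply: eq_bigr => e _.
  by rewrite w_edge mulr_natr; case: (e \in c).
under eq_bigr do rewrite mulrBr.
rewrite sumrB (sum_by_value _ _ ul lL) (sum_by_value _ _ ul lR) -sumrB.
(* Only the source survives: nothing enters it and its weight is 1, the sink has weight 0, and the
   other faces balance. *)
rewrite (bigD1_seq source) //=; last by rewrite mem_undup inE eqxx.
rewrite [X in _ + X]big_seq_cond [X in _ + X]big1 ?addr0 => [|F /andP[Fl Fs]].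
  rewrite !eqE f_source w_source [X in _ - X * _]big1 ?mul0r ?subr0 ?mulr1 //.
  by move=> e /asboolP/esym E; case: (@source_neq_sideR _ _ _ _ S e).
rewrite !eqE; have [->|Ft] := eqVneq F sink; first by rewrite w_sink !mulr0 subrr.
by rewrite f_balance ?subrr //; [exact: l_bounded | exact/eqP | exact/eqP].
Qed.

(** Any chain from [v] to the top completes the chosen chain below [v] to a maximal one, so [X v] is
    1 minus the flow on it. This removes the dependence on the choice, and for an edge [e] one
    compares the chains [c] and [e :: c]. *)
Lemma flow_potential : exists X : hat P -> R,
  [/\ X (hat0 P) = 0, X (hat1 P) = 1 & forall e, f e = X (upper e) - X (lower e)].
Proof.
have /choice[cv cvP] := @chain_from_hat0 _ P.
pose X v := \sum_(e <- cv v) f e.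
have XE v c : chain v c (hat1 P) -> X v = 1 - \sum_(e <- c) f e.
  move=> hc; have := maximal_chain_flow (chain_cat (cvP v) hc).
  by rewrite big_cat /= -/(X v); lra.
exists X; split.
- have [c hc] := chain_from_hat0 (hat1 P).
  by rewrite (XE _ c) // maximal_chain_flow ?subrr.
- by rewrite (XE _ [::]) // big_nil subr0.
- move=> e; have [c hc] := chain_to_hat1 (upper e).
  by rewrite (XE _ c hc) (XE (lower e) (e :: c)) //= big_cons; lra.
Qed.

End FlowPotential.

(** * The difference map from the order polytope to the flow polytope *)

Section HasseFlow.
Variables (R : realType) (disp : Order.disp_t) (P : finPOrderType disp).
Variables (D : upward_embedding R P) (S : side_edges D).
Implicit Types (x : {ffun P -> R^o}) (e : hasse_edge P).

Local Notation G := (truncated_dual S).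
Local Notation H := (hasse_graph S).
Local Notation sideL e := (side H false (inl e)).
Local Notation sideR e := (side H true (inl e)).
Local Notation source := (side H true (inr false)).
Local Notation sink := (side H false (inr true)).

Definition dual_of e : edge G := exist _ e (asboolT (edge_separates S e)).

Lemma dual_of_bij : bijective dual_of.
Proof. by exists val => // d; apply: val_inj. Qed.

Lemma outflowE (fl : {ffun edge G -> R^o}) F :
  outflow fl F = \sum_(e | `[< sideL e = F >]) fl (dual_of e).
Proof.
rewrite /outflow (reindex dual_of) /=; last exact/onW_bij/dual_of_bij.
by apply: eq_bigl => e; rewrite left_faceE.
Qed.

Lemma inflowE (fl : {ffun edge G -> R^o}) F :
  inflow fl F = \sum_(e | `[< sideR e = F >]) fl (dual_of e).
Proof.
rewrite /inflow (reindex dual_of) /=; last exact/onW_bij/dual_of_bij.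
by apply: eq_bigl => e; rewrite right_faceE.
Qed.

(* [k = 1] gives the affine map of the theorem, [k = 0] its linear part. *)
Definition hat_ext (k : R) x (v : hat P) : R :=
  match v with inl p => x p | inr b => k * b%:R end.

Definition hasse_diff (k : R) x : {ffun edge G -> R^o} :=
  [ffun d : edge G => hat_ext k x (upper (val d)) - hat_ext k x (lower (val d))].

Lemma hasse_diff_linear : linear (hasse_diff 0).
Proof.
move=> k x z; apply/ffunP => d; rewrite !ffunE.
by rewrite /hat_ext; case: (upper _) => [p|b]; case: (lower _) => [q|b'];
  rewrite ?ffunE ?mul0r /GRing.scale /=; lra.
Qed.

HB.instance Definition _ :=
  GRing.isLinear.Build R {ffun P -> R^o} {ffun edge G -> R^o} _ (hasse_diff 0)
    hasse_diff_linear.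

Lemma hasse_diff_affine : affine_map (hasse_diff 1).
Proof.
(* The translation [hasse_diff 1 0] is 1 on the edges into the top and 0 elsewhere. *)
exists (hasse_diff 0 : {linear {ffun P -> R^o} -> {ffun edge G -> R^o}}), (hasse_diff 1 0).
move=> x; apply/ffunP => d; rewrite !ffunE.
by rewrite /hat_ext; case: (upper _) => [p|b]; case: (lower _) => [q|b'];
  rewrite ?ffunE ?mul0r /=; lra.
Qed.

Lemma hasse_diffE x e :
  hasse_diff 1 x (dual_of e) = hat_ext 1 x (upper e) - hat_ext 1 x (lower e).
Proof. by rewrite ffunE. Qed.

(** Telescoping inverts the map with integer coefficients, which gives both injectivity and the
    transfer of integrality. *)
Lemma hat_ext_chain x p c : chain (hat0 P) c (inl p) ->
  x p = \sum_(e <- c) hasse_diff 1 x (dual_of e).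
Proof.
move=> hc; under eq_bigr do rewrite hasse_diffE.
by rewrite (chain_telescope _ hc) /= mulr0 subr0.
Qed.

Lemma hasse_diff_inj : injective (hasse_diff 1).
Proof.
move=> x z E; apply/ffunP => p; have [c hc] := chain_from_hat0 (inl p).
by rewrite (hat_ext_chain x hc) (hat_ext_chain z hc) E.
Qed.

Lemma hasse_diff_integral x : integral_point (hasse_diff 1 x) <-> integral_point x.
Proof.
split=> h.
  move=> p; have [c hc] := chain_from_hat0 (inl p).
  by rewrite (hat_ext_chain x hc); apply: rpred_sum => e _; exact: h.
have hX v : hat_ext 1 x v \is a Num.int.
  by case: v => [p|b] /=; [exact: h | rewrite mul1r; exact: rpred_nat].
by move=> d; rewrite ffunE; apply: rpredB.
Qed.

Lemma hasse_diff_image :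
  hasse_diff 1 @` order_polytope R P
  = flow_polytope R G (leftmost_face S) (rightmost_face S).
Proof.
rewrite leftmost_faceE rightmost_faceE; apply/seteqP; split.
  move=> _ [x [x01 xmon] <-].
  have mono u w : hat_lt u w -> hat_ext 1 x u <= hat_ext 1 x w.
    case: u w => [p|b] [q|b'] /=; first by move=> /ltW; exact: xmon.
    - by move=> ->; rewrite mul1r; have /andP[] := x01 p.
    - by move=> /negbTE ->; rewrite mulr0; have /andP[] := x01 q.
    - by case: b b' => [] [] //= _; rewrite !mul1r.
  (* The potential is 0 at the bottom and 1 at the top, and a Hasse edge enters [F] with the sign of
     its jump. *)
  have net F : bounded_face S F -> inflow (hasse_diff 1 x) F - outflow (hasse_diff 1 x) F
      = `[< sink = F >]%:R - `[< source = F >]%:R.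
    move=> [_ bF]; have := net_flow_potential S (hat_ext 1 x) bF.
    rewrite /= mulr1 mulr0 subr0 mul1r => <-.
    rewrite inflowE outflowE !(big_mkcond (fun e => `[< _ >])) -sumrB.
    apply: eq_bigr => e _; rewrite hasse_diffE /jump.
    by case: asboolP => _; case: asboolP => _ /=; rewrite ?mulr1n ?mulr0n; lra.
  split.
  - by move=> d; rewrite ffunE subr_ge0; apply: mono; exact: edge_lt.
  - have := net _ (side_side_edge_bounded S false).
    rewrite inflowE big1 => [|e /asboolP/esym E]; last by case: (@source_neq_sideR _ _ _ _ S e).
    by rewrite asboolF ?asboolT //=; [move=> h; lra | exact/nesym/source_neq_sink].
  - have := net _ (side_side_edge_bounded S true).
    rewrite outflowE big1 => [|e /asboolP E]; last by case: (@sideL_neq_sink _ _ _ _ S e).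
    by rewrite asboolT // asboolF /=; [move=> h; lra | exact/source_neq_sink].
  - move=> F bF /nesym Fs /nesym Ft; apply/eqP; rewrite -subr_eq0 net //.
    by rewrite !asboolF // subrr.
move=> fl [fl0 fls flt flF].
have [||X [X0 X1 XE]] := @flow_potential _ _ _ _ S (fun e => fl (dual_of e)).
- by rewrite -outflowE.
- by move=> F bF Fs Ft; rewrite -outflowE -inflowE; exact: flF.
pose x : {ffun P -> R^o} := [ffun p => X (inl p)].
have extE v : hat_ext 1 x v = X v.
  by case: v => [p|[]]; rewrite /= ?ffunE ?mulr1 ?mulr0.
(* Nonnegative flow along a chain makes the potential monotone; comparison with bottom and top then
   puts its values in the unit interval. *)
have Xmono u w : hat_lt u w -> X u <= X w.
  move=> /chain_exists[c hc]; rewrite -subr_ge0 -(chain_telescope X hc).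
  by apply: sumr_ge0 => e _; rewrite -XE.
exists x.
  split=> [p|p q]; rewrite !ffunE; first by rewrite -X0 -X1 !Xmono.
  by rewrite le_eqVlt => /orP[/eqP ->//|pq]; exact: Xmono.
apply/ffunP => d; have [e ->] : exists e, d = dual_of e.
  by exists (val d); apply: val_inj.
by rewrite hasse_diffE !extE -XE.
Qed.

End HasseFlow.

Theorem theorem3p10 (R : realType) (disp : Order.disp_t)
    (P : finPOrderType disp) (hP : strongly_planar R P)
    (D : upward_embedding R P) (S : side_edges D) :
  let G := truncated_dual S in
  let OP := order_polytope R P in
  let FG := flow_polytope R G (leftmost_face S) (rightmost_face S) in
  exists phi : {ffun P -> R^o} -> {ffun edge G -> R^o},
    [/\ affine_map phi,
        phi @` OP = FG
      & forall A, A `<=` OP ->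
          relative_volume FG (phi @` A) = relative_volume OP A].
Proof.
move=> G OP FG; exists (hasse_diff S 1); split.
- exact: hasse_diff_affine.
- exact: hasse_diff_image.
- move=> A _; rewrite /FG -hasse_diff_image; apply: relative_volume_image.
  + exact: hasse_diff_affine.
  + exact: hasse_diff_inj.
  + exact: hasse_diff_integral.
Qed.
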